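(* Let $\alpha,\beta\in\Pi$, $\alpha\neq\beta$, and $m,n\ge0$. The following relations hold when applied to any element of any object $M$ of $\mathcal X$. (1) If $\langle\alpha,\beta^\vee\rangle=0$, then $F_{\alpha,m}F_{\beta,n}=F_{\beta,n}F_{\alpha,m}$ and $E_{\alpha,m}E_{\beta,n}=E_{\beta,n}E_{\alpha,m}$. (2) If $\langle\alpha,\beta^\vee\rangle=-1$ and $m\ge2$, then $$\sum_{r\in\mathbb Z}(-1)^rq^{r(2-m)}F_{\alpha,r}F_{\beta,1}F_{\alpha,m-r}=0,\qquad \sum_{r\in\mathbb Z}(-1)^rq^{r(2-m)}E_{\alpha,r}E_{\beta,1}E_{\alpha,m-r}=0.$$
   Context: $R$ is a simply laced root system (i.e. $\langle\alpha,\beta^\vee\rangle\in\{0,-1\}$ for $\alpha\ne\beta$ in the basis) with basis $\Pi$ and weight lattice $X$; $\alpha^\vee$ is the coroot of $\alpha$. Partial order on $X$: $\mu\le\lambda$ iff $\lambda-\mu$ is a (possibly empty) sum of elements of $\Pi$. A subset $T\subset X$ is quasi-bounded (from above) if for all $\mu\in X$ the set $\{\lambda\in T\mid\mu\le\lambda\}$ is finite. $K$ is a field and $q\in K^\times$ is an arbitrary invertible element. Quantum numbers: in $\mathbb Z[v,v^{-1}]$ set $[n]=\frac{v^n-v^{-n}}{v-v^{-1}}$ for $n\in\mathbb Z$, and for $a,b\in\mathbb Z$ let ${a\brack b}=\frac{[a][a-1]\cdots[a-b+1]}{[1][2]\cdots[b]}\in\mathbb Z[v,v^{-1}]$ if $b>0$,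 ${a\brack 0}=1$, and ${a\brack b}=0$ if $b<0$. These are regarded as elements of $K$ via $v\mapsto q$. The category $\mathcal X=\mathcal X_{(K,q)}$: objects are $X$-graded $K$-vector spaces $M=\bigoplus_{\mu\in X}M_\mu$ with $K$-linear operators $E_{\alpha,n}=E_{\mu,\alpha,n}\colon M_\mu\to M_{\mu+n\alpha}$ and $F_{\alpha,n}=F_{\mu,\alpha,n}\colon M_{\mu+n\alpha}\to M_\mu$ for all $\mu\in X$, $\alpha\in\Pi$, $n>0$ (with $E_{\mu,\alpha,0}=F_{\mu,\alpha,0}=\operatorname{id}_{M_\mu}$ and $E_{\mu,\alpha,n}=F_{\mu,\alpha,n}=0$ for $n<0$), such that: (X1) The set of $\mu$ with $M_\mu\ne0$ is quasi-bounded from above and each $M_\mu$ is finite dimensional. (X2) For all $\mu\in X$, $\alpha,\beta\in\Pi$, $m,n>0$ and $v\in M_{\mu+n\beta}$: $E_{\alpha,m}F_{\beta,n}(v)=F_{\beta,n}E_{\alpha,m}(v)$ if $\alpha\ne\beta$, and $E_{\alpha,m}F_{\alpha,n}(v)=\sum_{r\in\mathbb Z}{\langle\mu,\alpha^\vee\rangle+m+n\brack r}F_{\alpha,n-r}E_{\alpha,m-r}(v)$ if $\alpha=\beta$. (X3) For all $\mu\in X$: $M_\mu=\ker E_\mu\oplus\operatorname{im}F_\mu$, where $M_{\delta\mu}:=\bigoplus_{\alpha\in\Pi,n>0}M_{\mu+n\alpha}$, $E_\mu\colon M_\mu\to M_{\delta\mu}$ has components $E_{\mu,\alpha,n}$,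 and $F_\mu\colon M_{\delta\mu}\to M_\mu$ is $(v_{\mu+n\alpha})\mapsto\sum_{\alpha,n}F_{\mu,\alpha,n}(v_{\mu+n\alpha})$. Morphisms are grading-preserving $K$-linear maps commuting with all $E$- and $F$-operators. *)

(* Defs.v *)
From HB Require Import structures.
From mathcomp Require Import all_boot all_order all_algebra.
From mathcomp Require Import mathcomp_extra boolp classical_sets functions.
From mathcomp Require Import cardinality fsbigop.
Set Implicit Arguments.
Unset Strict Implicit.
Unset Printing Implicit Defensive.
Import Order.TTheory GRing.Theory Num.Theory.
Local Open Scope ring_scope.
Local Open Scope classical_set_scope.

(* Root systems are finite, crystallographic and reduced. The ground field is
   any archimedean ordered field, so that both rational and real root systems
   are covered; coroots are linear forms, here elements of 'Hom(V, F^o). *)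
Record root_system (F : archiRealFieldType) (V : vectType F) := RootSystem {
  roots : seq V;
  coroot : V -> 'Hom(V, F^o);
  roots_span : <<roots>>%VS = fullv;
  roots_neq0 : 0 \notin roots;
  coroot_root : {in roots, forall a, coroot a a = 2};
  roots_refl : {in roots &, forall a b, b - coroot a b *: a \in roots};
  roots_int : {in roots &, forall a b, coroot a b \is a Num.int};
  roots_reduced : forall (a : V) (c : F),
    a \in roots -> c *: a \in roots -> c = 1 \/ c = -1
}.

Record root_base (F : archiRealFieldType) (V : vectType F)
    (R : root_system V) := RootBase {
  base : seq V;
  base_roots : {subset base <= roots R};
  base_free : free base;
  base_gen : forall b, b \in roots R -> exists c : V -> nat,
    b = \sum_(a <- base) a *+ c a \/ b = - \sum_(a <- base) a *+ c a
}.

Definition simple_root (F : archiRealFieldType) (V : vectType F)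
  (R : root_system V) (Pi : root_base R) : finType := seq_sub (base Pi).

Definition is_weight (F : archiRealFieldType) (V : vectType F)
  (R : root_system V) : {pred V} :=
  fun x => all (fun a => coroot R a x \is a Num.int) (roots R).

Lemma is_weight_zmod (F : archiRealFieldType) (V : vectType F)
  (R : root_system V) : zmod_closed (is_weight R).
Proof.
split=> [|x y /allP Hx /allP Hy]; apply/allP=> a Ra; first by rewrite linear0.
by rewrite linearB rpredB ?Hx ?Hy.
Qed.
HB.instance Definition _ (F : archiRealFieldType) (V : vectType F)
  (R : root_system V) :=
  GRing.isZmodClosed.Build V (@is_weight F V R) (@is_weight_zmod F V R).

(* The weight lattice {x in V | <x, a^vee> in Z for all roots a}. *)
Record weight (F : archiRealFieldType) (V : vectType F)
  (R : root_system V) := Weight { wval :> V; _ : wval \in is_weight R }.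
HB.instance Definition _ (F : archiRealFieldType) (V : vectType F)
  (R : root_system V) :=
  [isSub for @wval F V R].
HB.instance Definition _ (F : archiRealFieldType) (V : vectType F)
  (R : root_system V) :=
  [Choice of @weight F V R by <:].
HB.instance Definition _ (F : archiRealFieldType) (V : vectType F)
  (R : root_system V) :=
  [SubChoice_isSubZmodule of @weight F V R by <:].

Lemma simple_root_weight (F : archiRealFieldType) (V : vectType F)
  (R : root_system V) (Pi : root_base R) (a : simple_root Pi) :
  ssval a \in is_weight R.
Proof.
by apply/allP=> b Rb; apply: roots_int => //; apply: base_roots (ssvalP a).
Qed.

Definition sroot (F : archiRealFieldType) (V : vectType F)
  (R : root_system V) (Pi : root_base R) (a : simple_root Pi) : weight R :=
  Weight (simple_root_weight a).

(* <mu, a^vee>; the value in F is integral, so floor only changes its type. *)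
Definition pairing (F : archiRealFieldType) (V : vectType F)
  (R : root_system V) (Pi : root_base R) (mu : weight R)
  (a : simple_root Pi) : int := Num.floor (coroot R (ssval a) (wval mu) : F).

Definition simply_laced (F : archiRealFieldType) (V : vectType F)
  (R : root_system V) (Pi : root_base R) : Prop :=
  forall a b : simple_root Pi, a != b ->
    pairing (sroot a) b = 0 \/ pairing (sroot a) b = -1.

Definition wle (F : archiRealFieldType) (V : vectType F)
  (R : root_system V) (Pi : root_base R) (mu lambda : weight R) : Prop :=
  exists s : seq (simple_root Pi), lambda - mu = \sum_(a <- s) sroot a.

Definition quasi_bounded (F : archiRealFieldType) (V : vectType F)
  (R : root_system V) (Pi : root_base R) (T : set (weight R)) : Prop :=
  forall mu : weight R, finite_set [set lambda | T lambda /\ wle Pi mu lambda].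

(* Z[v, v^-1] is viewed inside the fraction field of Z[v]. *)
Definition qv : {fraction {poly int}} := tofrac 'X.

Definition qint (n : int) : {fraction {poly int}} :=
  (qv ^ n - qv ^ (- n)) / (qv - qv^-1).

Definition qbin (a b : int) : {fraction {poly int}} :=
  match b with
  | Posz k => (\prod_(0 <= i < k) qint (a - i%:Z)) /
              (\prod_(1 <= i < k.+1) qint i%:Z)
  | Negz _ => 0
  end.

(* The specialisation Z[v, v^-1] -> K, v |-> q: a Laurent polynomial
   x = p(v) / v^n is sent to p(q) / q^n, which for q != 0 does not depend on
   the chosen presentation. Junk value 0 outside Z[v, v^-1]. *)
Definition laurent_eval (K : fieldType) (q : K) (x : {fraction {poly int}}) : K :=
  let pn := xget (0, 0%N)
    [set pn : {poly int} * nat | x = tofrac pn.1 / qv ^+ pn.2] in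
  (map_poly intr pn.1).[q] / q ^+ pn.2.

(* X-graded vector spaces with E- and F-operators. The grading is internal:
   wspace mu is the subspace M_mu of M, and M is the direct sum of these. The
   operators E_{mu,a,n} for all mu are the restrictions to the M_mu of a single
   linear endomorphism E a n of M, and F_{mu,a,n} is the restriction of F a n
   to M_{mu + n a}. *)
Record op_module (F : archiRealFieldType) (V : vectType F)
    (R : root_system V) (Pi : root_base R) (K : fieldType) := OpModule {
  carrier :> lmodType K;
  wspace : weight R -> {pred carrier};
  wspace_sub : forall mu, submod_closed (wspace mu);
  wspace_span : forall v : carrier, exists (s : seq (weight R)) (f : weight R -> carrier),
    (forall mu, f mu \in wspace mu) /\ v = \sum_(mu <- s) f mu;
  wspace_direct : forall (s : seq (weight R)) (f : weight R -> carrier),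
    uniq s -> (forall mu, f mu \in wspace mu) -> \sum_(mu <- s) f mu = 0 ->
    forall mu, mu \in s -> f mu = 0;
  opE : simple_root Pi -> int -> {linear carrier -> carrier};
  opF : simple_root Pi -> int -> {linear carrier -> carrier};
  opE_deg : forall mu a n v, 0 < n ->
    v \in wspace mu -> opE a n v \in wspace (mu + sroot a *~ n);
  opF_deg : forall mu a n v, 0 < n ->
    v \in wspace (mu + sroot a *~ n) -> opF a n v \in wspace mu;
  opE0 : forall a v, opE a 0 v = v;
  opF0 : forall a v, opF a 0 v = v;
  opE_neg : forall a n v, n < 0 -> opE a n v = 0;
  opF_neg : forall a n v, n < 0 -> opF a n v = 0
}.
Arguments wspace {F V R Pi K} o mu.
Arguments opE {F V R Pi K o} a n.
Arguments opF {F V R Pi K o} a n.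

Definition axiomX1 (F : archiRealFieldType) (V : vectType F)
  (R : root_system V) (Pi : root_base R) (K : fieldType)
  (M : op_module Pi K) : Prop :=
  quasi_bounded Pi [set mu | exists2 v : M, v \in wspace M mu & v != 0] /\
  forall mu, exists (d : nat) (b : 'I_d -> M),
    (forall i, b i \in wspace M mu) /\
    (forall v : M, v \in wspace M mu -> exists c : 'I_d -> K, v = \sum_i c i *: b i).

Definition axiomX2 (F : archiRealFieldType) (V : vectType F)
  (R : root_system V) (Pi : root_base R) (K : fieldType) (q : K)
  (M : op_module Pi K) : Prop :=
  forall (mu : weight R) (a b : simple_root Pi) (m n : int) (v : M),
    0 < m -> 0 < n -> v \in wspace M (mu + sroot b *~ n) ->
    (a != b -> opE a m (opF b n v) = opF b n (opE a m v)) /\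
    (a = b -> opE a m (opF a n v) =
       \sum_(r \in [set: int])
          laurent_eval q (qbin (pairing mu a + m + n) r)
            *: opF a (n - r) (opE a (m - r) v)).

Definition kerE (F : archiRealFieldType) (V : vectType F)
  (R : root_system V) (Pi : root_base R) (K : fieldType)
  (M : op_module Pi K) (mu : weight R) (v : M) : Prop :=
  v \in wspace M mu /\
  forall (a : simple_root Pi) (n : int), 0 < n -> opE a n v = 0.
Arguments kerE {F V R Pi K} M mu v.

(* Since Pi is finite, an element of the direct sum of the M_{mu + n a} over
   a in Pi and n > 0 is a family w supported in 0 < n < N for some N. *)
Definition imF (F : archiRealFieldType) (V : vectType F)
  (R : root_system V) (Pi : root_base R) (K : fieldType)
  (M : op_module Pi K) (mu : weight R) (v : M) : Prop :=
  exists (N : nat) (w : simple_root Pi -> nat -> M),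
    (forall a n, (0 < n < N)%N -> w a n \in wspace M (mu + sroot a *~ n%:Z)) /\
    v = \sum_(a : simple_root Pi) \sum_(1 <= n < N) opF a n%:Z (w a n).
Arguments imF {F V R Pi K} M mu v.

Definition axiomX3 (F : archiRealFieldType) (V : vectType F)
  (R : root_system V) (Pi : root_base R) (K : fieldType)
  (M : op_module Pi K) : Prop :=
  forall mu : weight R,
    (forall v : M, v \in wspace M mu ->
       exists k i : M, [/\ kerE M mu k, imF M mu i & v = k + i]) /\
    (forall v : M, kerE M mu v -> imF M mu v -> v = 0).

Record objX (F : archiRealFieldType) (V : vectType F)
    (R : root_system V) (Pi : root_base R) (K : fieldType) (q : K) := ObjX {
  objX_module :> op_module Pi K;
  objX_X1 : axiomX1 objX_module;
  objX_X2 : axiomX2 q objX_module;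
  objX_X3 : axiomX3 objX_module
}.

(* Main.v *)
Require Import Defs.
From mathcomp Require Import all_boot all_order all_algebra.
From mathcomp Require Import classical_sets fsbigop cardinality.
From mathcomp Require Import ring lra zify.
Import Order.TTheory GRing.Theory Num.Theory.
Local Open Scope ring_scope.

(** Write F^(n), E^(n) for the operators attached to a simple root a.  Each
    relation is an operator R that has to vanish on every weight space, and
    it is proved by downward induction on the weight: axiomX1 and the
    height function bound the weights of M above a given one, so that a
    relation may be assumed on all strictly higher weight spaces
    (weight_ind).

    For a relation in the F-operators, R v lies in the image of the
    F-operators, so by axiomX3 it vanishes once every E-operator kills it
    (F_ind, ker_im).  Moving an E-operator to the right by axiomX2 produces the
    same relation applied to E-images of v, which live in higher weights, or
    to v itself, but then in smaller degree.  For a relation in the E-operators one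
    writes v = k + sum of F u by axiomX3; the relation is clear on k, which all
    E-operators kill, and moving F to the left turns the relation on F u into
    relations on u, again of higher weight (E_ind).

    What has to be checked is that the coefficients produced by axiomX2 recombine.
    - For a, b orthogonal the coefficients do not see the other root, and
      nothing happens (F_comm, E_comm).
    - In the Serre relation with an operator of b, one is left with
      F_a^(r) F_a^(m-r) for varying r.  These are multiples of F_a^(m), which
      is itself a relation to be proved (F_divpow, E_divpow); its coefficient
      identity is the q-Pfaff-Saalschuetz sum.  The remaining scalar is an
      alternating sum of quantum binomials, and it is zero.
    - In the Serre relation of degree m with an operator of a, the terms group
      into Serre relations of degree m - t, each with the coefficient
      [m-2 choose t] up to a sign and a power of q, by the q-Vandermonde
      identity.  For t > m - 2 this coefficient is zero, and these are exactly
      the degrees m - t < 2, in which there is no Serre relation (F_serre,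
      E_serre).

    The binomial identities are proved in the fraction field of Z[v], where
    quantum integers can be divided by, and specialised to v = q afterwards,
    which is legitimate because quantum binomials are Laurent polynomials.
    This is what allows q to be a root of unity. *)

(** * Quantum numbers and binomials at a parameter of infinite order *)

Section QuantumNumbers.
Variables (L : fieldType) (z : L).

(** At the generic parameter these are the given quantum integers and
    binomials; an abstract field keeps the computations independent of the
    construction of fractions. *)
Definition qnum (n : int) : L := (z ^ n - z ^ (- n)) / (z - z^-1).

Definition qbinom (a b : int) : L :=
  match b with
  | Posz k => (\prod_(0 <= i < k) qnum (a - i%:Z)) /
              (\prod_(1 <= i < k.+1) qnum i%:Z)
  | Negz _ => 0
  end.

Lemma qnum0 : qnum 0 = 0.
Proof. by rewrite /qnum oppr0 subrr mul0r. Qed.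

Lemma qnumN n : qnum (- n) = - qnum n.
Proof. by rewrite /qnum opprK -mulNr opprB. Qed.

Lemma qbinom0 a : qbinom a 0 = 1.
Proof. by rewrite /qbinom /= !big_geq // invr1 mulr1. Qed.

Lemma qbinom_lt0 a b : b < 0 -> qbinom a b = 0.
Proof. by case: b. Qed.

Lemma qbinom_small (a b : int) : 0 <= a -> a < b -> qbinom a b = 0.
Proof.
case: a => // a _; case: b => // b /=; rewrite ltz_nat => ltab.
rewrite big_mkord (bigD1 (Ordinal ltab)) //=.
by rewrite subrr qnum0 !mul0r.
Qed.

Hypothesis z_neq0 : z != 0.
Hypothesis z_nroot : forall n, z ^+ n.+1 != 1.

Lemma qnum_neq0 (n : int) : 0 < n -> qnum n != 0.
Proof.
have nz m : z ^+ m.+1 - z ^- m.+1 != 0.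
  rewrite -(inj_eq (mulfI (expf_neq0 m.+1 z_neq0))) mulr0 mulrBr mulfV ?expf_neq0 //.
  by rewrite -exprD addnS subr_eq0 z_nroot.
case: n => // -[//|n] _; rewrite /qnum mulf_neq0 //.
  exact: (nz n).
by rewrite invr_eq0; apply: (nz 0%N).
Qed.

Lemma qnum1 : qnum 1 = 1.
Proof.
rewrite /qnum divff //; have := @qnum_neq0 1 isT.
by rewrite /qnum mulf_eq0 negb_or => /andP[].
Qed.

Let d_neq0 : z - z^-1 != 0.
Proof.
by have := @qnum_neq0 1 isT; rewrite /qnum mulf_eq0 negb_or invr_eq0 => /andP[].
Qed.

(** The source of all absorption arguments below: it splits a factor [a + b]
    into one multiple of [a] and one of [b]. *)
Lemma qnumD a b : qnum (a + b) = z ^ (- b) * qnum a + z ^ a * qnum b.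
Proof.
rewrite /qnum !opprD !expfzDr // -!invr_expz.
have [A0 B0] : z ^ a != 0 /\ z ^ b != 0 by rewrite !expfz_neq0.
have := d_neq0; move: (z - _) (z ^ a) (z ^ b) A0 B0 => d A B A0 B0 D0.
by field; rewrite A0 B0 D0.
Qed.

(** Up to a constant [x-y] is the 2 x 2 minor z^x z^(-y) - z^(-x) z^y, and this is
    the Pluecker relation for the four points a, b, c and -1. *)
Lemma qnum_exchange a b c :
  qnum (a - b) * qnum (c + 1) + qnum (c - a) * qnum (b + 1)
    = qnum (a + 1) * qnum (c - b).
Proof.
rewrite /qnum !opprD !expfzDr // -!invr_expz !expr1z.
have [[A0 B0] C0] : (z ^ a != 0 /\ z ^ b != 0) /\ z ^ c != 0.
  by rewrite !expfz_neq0.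
have := d_neq0; set d := z - _.
move: d (z ^ a) (z ^ b) (z ^ c) A0 B0 C0 => d A B C A0 B0 C0 D0.
by field; rewrite D0 B0 oner_neq0 C0 z_neq0 A0.
Qed.

Lemma qbinomS a (b : nat) :
  qbinom a (b%:Z + 1) = qbinom a b * qnum (a - b%:Z) / qnum (b%:Z + 1).
Proof.
rewrite -[_ + 1]/(Posz (b + 1)%N) addn1 /= big_nat_recr //= (@big_nat_recr _ _ _ b.+1 1) //=.
rewrite invfM; ring.
Qed.

Lemma mul_qnum_qbinom_pred a b :
  qnum b * qbinom a b = qnum a * qbinom (a - 1) (b - 1).
Proof.
case: b => [[|b]|b]; last by rewrite !mulr0.
  by rewrite qnum0 mul0r mulr0.
have -> : b.+1%:Z - 1 = b by rewrite -addn1 PoszD addrK.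
rewrite /qbinom [in LHS]big_nat_recl //= subr0 [in LHS]big_nat_recr //=.
under eq_bigr => i _.
  have -> : a - i.+1%:Z = a - 1 - i%:Z by rewrite -addn1 PoszD; ring.
  over.
have := @qnum_neq0 b.+1 isT.
rewrite invfM; move: (_^-1) (qnum b.+1) => D M M0.
by field.
Qed.

Local Opaque qnum qbinom.

Lemma mul_qnum_qbinom_lower a (b : nat) :
  qnum (b%:Z + 1) * qbinom a (b%:Z + 1) = qnum (a - b%:Z) * qbinom a b.
Proof.
have b1 : qnum (b%:Z + 1) != 0 by apply: qnum_neq0; rewrite addrC.
by rewrite qbinomS mulrC divfK // mulrC.
Qed.

Lemma qbinom_pascal a (b : nat) :
  qbinom (a + 1) (b%:Z + 1) =
    z ^ (b%:Z + 1) * qbinom a (b%:Z + 1) + z ^ (b%:Z - a) * qbinom a b.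
Proof.
have b1 : qnum (b%:Z + 1) != 0 by apply: qnum_neq0; rewrite addrC.
apply: (mulfI b1); rewrite mul_qnum_qbinom_pred !addrK.
rewrite (_ : a + 1 = b%:Z + 1 + (a - b%:Z)); last by ring.
rewrite qnumD opprB; have := mul_qnum_qbinom_lower a b.
move: (qnum _) (qnum _) (qbinom _ _) (qbinom _ _) => Q1 Q2 B1 B2 E.
by ring: E.
Qed.

(** The case r = 1 of qbinom_saalschutz with its two terms written out; it
    drives the induction there. *)
Lemma qbinom_rec r a (b : nat) :
  qnum r * qbinom a b =
    qnum (r - b%:Z) * qbinom (a + 1) b + qnum (a - r + 1) * qbinom a (b%:Z - 1).
Proof.
case: b => [|b].
  by rewrite !qbinom0 (@qbinom_lt0 _ (0%:Z - 1)) // mulr0 addr0 subr0.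
have -> : b.+1%:Z = b%:Z + 1 by rewrite -addn1.
have b1 : qnum (b%:Z + 1) != 0 by apply: qnum_neq0; rewrite addrC.
apply: (mulfI b1); have E1 := mul_qnum_qbinom_lower a b.
have := mul_qnum_qbinom_pred (a + 1) (b%:Z + 1); rewrite !addrK => E2.
have := esym (qnum_exchange (r - 1) b a); rewrite subrK.
rewrite (_ : r - (b%:Z + 1) = r - 1 - b%:Z); last by ring.
rewrite (_ : a - r + 1 = a - (r - 1)); last by ring.
move: (qnum _) (qnum _) (qnum _) (qnum _) (qnum _) (qnum _) E1 E2 => Q1 Q2 Q3 Q4 Q5 Q6.
move: (qbinom _ _) (qbinom _ _) (qbinom _ _) => B1 B2 B3 E1 E2 E3.
by rewrite mulrCA E1 mulrA E3; ring: E2.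
Qed.

(** The q-Pfaff-Saalschuetz sum.  Its right hand side is the coefficient of
    F^(r+s-t) E^(k-t) when E^(k) is moved past [r+s choose r] F^(r+s), its left
    hand side the one obtained by moving E^(k) past F^(r) F^(s).  After
    multiplication by [r], qbinom_rec splits the first factor and the sum
    falls apart into two sums of the same shape with r - 1 in place of r. *)
Lemma qbinom_saalschutz (r s t : nat) (a : int) :
  \sum_(i < t.+1) qbinom (a - s%:Z) i * qbinom (a + r%:Z - i%:Z) (t%:Z - i%:Z)
      * qbinom (r%:Z + s%:Z - t%:Z) (r%:Z - i%:Z)
    = qbinom (r%:Z + s%:Z) r * qbinom a t.
Proof.
elim: r t a => [|r IH] t a.
  rewrite big_ord_recl big1 => [|i _].
    by rewrite !subr0 !qbinom0 !addr0 mul1r mulr1.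
  by rewrite [X in _ * X]qbinom_lt0 ?mulr0 // lift0 sub0r oppr_lt0.
have r1 : qnum r.+1 != 0 by apply: qnum_neq0.
have Er : r.+1%:Z = r%:Z + 1 by rewrite -addn1.
apply: (mulfI r1); rewrite mulr_sumr mulrA mul_qnum_qbinom_pred.
rewrite (_ : r.+1%:Z + s%:Z - 1 = r%:Z + s%:Z); last by rewrite Er; ring.
rewrite (_ : r.+1%:Z - 1 = r%:Z); last by rewrite Er addrK.
transitivity (qnum (r%:Z + s%:Z - t%:Z + 1) * (qbinom (r%:Z + s%:Z) r * qbinom (a + 1) t)
   + qnum (a - s%:Z - r%:Z) * (qbinom (r%:Z + s%:Z) r * qbinom a (t%:Z - 1))); last first.
  rewrite [RHS]mulrAC (qbinom_rec (r.+1%:Z + s%:Z)) mulrDl.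
  rewrite (_ : r.+1%:Z + s%:Z - t%:Z = r%:Z + s%:Z - t%:Z + 1); last by rewrite Er; ring.
  rewrite (_ : a - (r.+1%:Z + s%:Z) + 1 = a - s%:Z - r%:Z); last by rewrite Er; ring.
  by ring.
transitivity (\sum_(i < t.+1) (
   qnum (r%:Z + s%:Z - t%:Z + 1) * (qbinom (a + 1 - s%:Z) i *
     qbinom (a + 1 + r%:Z - i%:Z) (t%:Z - i%:Z) *
     qbinom (r%:Z + s%:Z - t%:Z) (r%:Z - i%:Z)) +
   qnum (a - s%:Z - r%:Z) * (qbinom (a - s%:Z) (i%:Z - 1) *
     qbinom (a + r%:Z + 1 - i%:Z) (t%:Z - i%:Z) *
     qbinom (r%:Z + s%:Z + 1 - t%:Z) (r%:Z + 1 - i%:Z)))).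
  apply: eq_bigr => i _.
  have E1 := qbinom_rec r.+1%:Z (a - s%:Z) i.
  have := mul_qnum_qbinom_pred (r%:Z + s%:Z - t%:Z + 1) (r.+1%:Z - i%:Z).
  rewrite Er addrK (_ : r%:Z + 1 - i%:Z - 1 = r%:Z - i%:Z) => [E2|]; last by ring.
  rewrite (_ : r%:Z + s%:Z + 1 - t%:Z = r%:Z + s%:Z - t%:Z + 1); last by ring.
  rewrite (_ : r%:Z + 1 + s%:Z - t%:Z = r%:Z + s%:Z - t%:Z + 1); last by ring.
  rewrite (_ : a + (r%:Z + 1) - i%:Z = a + r%:Z + 1 - i%:Z); last by ring.
  rewrite (_ : a + 1 + r%:Z - i%:Z = a + r%:Z + 1 - i%:Z); last by ring.
  have assoc (x y w u : L) : x * (y * w * u) = (x * y) * (w * u) by ring.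
  rewrite [LHS]assoc -{1}Er E1 Er.
  rewrite (_ : a - s%:Z - (r%:Z + 1) + 1 = a - s%:Z - r%:Z); last by ring.
  rewrite (_ : a - s%:Z + 1 = a + 1 - s%:Z); last by ring.
  by ring: E2.
rewrite big_split -!mulr_sumr IH; congr (_ + _); congr (_ * _).
case: t => [|t].
  by rewrite big_ord_recl big_ord0 !(@qbinom_lt0 _ (0%:Z - 1)) // !mul0r mulr0 addr0.
have Et : t.+1%:Z = t%:Z + 1 by rewrite -addn1.
rewrite big_ord_recl (@qbinom_lt0 _ (0%:Z - 1)) // !mul0r add0r.
rewrite (_ : t.+1%:Z - 1 = t%:Z); last by rewrite Et addrK.
rewrite -IH; apply: eq_bigr => i _; rewrite lift0.
rewrite (_ : i.+1%:Z = i%:Z + 1) ?Et; last by rewrite -addn1.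
by congr (qbinom _ _ * qbinom _ _ * qbinom _ _); ring.
Qed.

(** After multiplication by [t] = z^(i-t) [i] + z^i [t-i], the factor [i]
    is absorbed by the first binomial and [t-i] by the second, which leaves two
    sums of the same shape for t - 1. *)
Lemma qbinom_vandermonde (t : nat) (a b : int) :
  \sum_(i < t.+1) z ^ (a * (t%:Z - i%:Z) - b * i%:Z) *
     (qbinom a i * qbinom b (t%:Z - i%:Z)) = qbinom (a + b) t.
Proof.
elim: t a b => [|t IH] a b.
  by rewrite big_ord_recl big_ord0 !subr0 !qbinom0 !mulr1 !mulr0 subrr expr0z addr0.
have t1 : qnum t.+1 != 0 by apply: qnum_neq0.
have Et : t.+1%:Z = t%:Z + 1 by rewrite -addn1.
apply: (mulfI t1); rewrite mulr_sumr mul_qnum_qbinom_pred qnumD.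
rewrite (_ : t.+1%:Z - 1 = t%:Z); last by rewrite Et addrK.
transitivity (\sum_(i < t.+2) (
   z ^ (- b) * qnum a * (z ^ ((a - 1) * (t%:Z + 1 - i%:Z) - b * (i%:Z - 1)) *
      (qbinom (a - 1) (i%:Z - 1) * qbinom b (t%:Z + 1 - i%:Z))) +
   z ^ a * qnum b * (z ^ (a * (t%:Z - i%:Z) - (b - 1) * i%:Z) *
      (qbinom a i * qbinom (b - 1) (t%:Z - i%:Z))))).
  apply: eq_bigr => i _.
  have := mul_qnum_qbinom_pred a i.
  have := mul_qnum_qbinom_pred b (t.+1%:Z - i%:Z).
  rewrite (_ : t.+1%:Z - i%:Z - 1 = t%:Z - i%:Z); last by rewrite Et; ring.
  have := qnumD i%:Z (t.+1%:Z - i%:Z); rewrite addrC subrK => ->.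
  rewrite Et.
  set u := t%:Z + 1 - i%:Z; set e := a * (t%:Z - i%:Z) - b * i%:Z.
  rewrite (_ : a * u - b * i%:Z = a + e); last by rewrite /u /e; ring.
  rewrite (_ : (a - 1) * u - b * (i%:Z - 1) = b + (a + e + (- u)));
    last by rewrite /u /e; ring.
  rewrite (_ : a * (t%:Z - i%:Z) - (b - 1) * i%:Z = e + i%:Z);
    last by rewrite /e; ring.
  rewrite !(expfzDr _ _ z_neq0).
  have Eb : z ^ (- b) * z ^ b = 1 by rewrite -expfzDr // addNr.
  move=> E1 E2; ring: E1 E2 Eb.
rewrite big_split -!mulr_sumr -addrA.
set S1 := \sum_i _; set S2 := \sum_i _.
have -> : S2 = qbinom (a + (b - 1)) t.
  rewrite /S2 big_ord_recr /= (@qbinom_lt0 _ (t%:Z - t.+1%:Z)) ?mulr0 ?addr0 ?IH //.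
  by rewrite Et opprD addrA subrr.
rewrite /= mulrDl; congr (_ * _ + _); rewrite {}/S1.
rewrite big_ord_recl (@qbinom_lt0 _ (0%:Z - 1)) // mul0r mulr0 add0r.
rewrite (_ : a + (b - 1) = a - 1 + b); last by ring.
rewrite -IH; apply: eq_bigr => i _; rewrite lift0.
rewrite (_ : i.+1%:Z = i%:Z + 1); last by rewrite -addn1.
by congr (z ^ _ * (qbinom _ _ * qbinom _ _)); ring.
Qed.

Lemma qbinom_negate a (b : nat) :
  qbinom a b = (-1) ^+ b * qbinom (b%:Z - 1 - a) b.
Proof.
elim: b => [|b IH]; first by rewrite !qbinom0 mulr1.
have b1 : qnum b.+1 != 0 by apply: qnum_neq0.
apply: (mulfI b1); have Eb : b.+1%:Z = b%:Z + 1 by rewrite -addn1.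
rewrite [RHS]mulrCA [in RHS]mul_qnum_qbinom_pred Eb addrK addrAC.
rewrite mul_qnum_qbinom_lower IH exprS -opprB qnumN.
by ring.
Qed.

Lemma qbinomnn (n : nat) : qbinom n n = 1.
Proof.
elim: n => [|n IH]; first by rewrite qbinom0.
have n1 : qnum n.+1 != 0 by apply: qnum_neq0.
apply: (mulfI n1); rewrite mul_qnum_qbinom_pred.
by rewrite (_ : n.+1%:Z - 1 = n) ?IH // -addn1 PoszD addrK.
Qed.

Lemma qbinom_sym (n r : nat) : (r <= n)%N -> qbinom n r = qbinom n (n%:Z - r%:Z).
Proof.
elim: r => [|r IH] lt_rn; first by rewrite subr0 qbinom0 qbinomnn.
have Er : r.+1%:Z = r%:Z + 1 by rewrite -addn1.
have r1 : qnum (r%:Z + 1) != 0 by rewrite -Er; apply: qnum_neq0.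
rewrite Er; apply: (mulfI r1); rewrite mul_qnum_qbinom_lower IH ?(ltnW lt_rn) //.
have := mul_qnum_qbinom_lower n (n - r.+1); rewrite -subzn // Er.
rewrite (_ : n%:Z - (r%:Z + 1) + 1 = n%:Z - r%:Z); last by ring.
by rewrite (_ : n%:Z - (n%:Z - (r%:Z + 1)) = r%:Z + 1); last by ring.
Qed.

Lemma qbinomN1 (n : nat) : qbinom (- 1) n = (-1) ^+ n.
Proof. by rewrite qbinom_negate opprK subrK qbinomnn mulr1. Qed.

(** The q-Vandermonde identity with b = -1, because [-1 choose i] = (-1)^i;
    its right hand side is [n choose n+1] = 0. *)
Lemma qbinom_altsum (n : nat) :
  \sum_(i < n.+2) (-1) ^+ i * z ^ (i%:Z * - n%:Z) * qbinom n.+1 i = 0.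
Proof.
have En : n.+1%:Z = n%:Z + 1 by rewrite -addn1.
have := qbinom_vandermonde n.+1 n.+1 (- 1).
rewrite (@qbinom_small (n.+1%:Z - 1)); first last.
- by rewrite ltrBlDr ltrDl.
- by rewrite En addrK.
move/(congr1 (fun x => (-1) ^+ n.+1 * z ^ (- (n.+1%:Z * n.+1%:Z)) * x)).
rewrite mulr0 mulr_sumr => E; rewrite -[RHS]E {E}; apply: eq_bigr => i _.
rewrite subzn ?leq_ord // qbinomN1 -subzn ?leq_ord //.
rewrite (_ : (-1) ^+ n.+1 = (-1) ^+ i * (-1) ^+ (n.+1 - i)); last first.
  by rewrite -exprD subnKC ?leq_ord.
rewrite (_ : i%:Z * - n%:Z = - (n.+1%:Z * n.+1%:Z) +
   (n.+1%:Z * (n.+1%:Z - i%:Z) - -1 * i%:Z)); last by rewrite En; ring.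
have E : (-1) ^+ (n.+1 - i) * (-1) ^+ (n.+1 - i) = 1 :> L.
  by rewrite -expr2 sqrr_sign.
rewrite (expfzDr _ _ z_neq0); ring: E.
Qed.

(** The scalar left over when an E- or F-operator of the other simple root is
    moved past a Serre combination of degree m.  Splitting
    [c+m-r] = z^(-c) [m-r] + z^(m-r) [c] gives two alternating sums, with
    upper indices m - 1 and m. *)
Lemma qbinom_serre_sum (m : nat) (c : int) : (1 < m)%N ->
  \sum_(r < m.+1) (-1) ^+ r * z ^ (r%:Z * (2 - m%:Z)) *
    (qnum (c + m%:Z - r%:Z) * qbinom m r) = 0.
Proof.
case: m => [|[|m]] // _.
have Em : m.+2%:Z = m.+1%:Z + 1 by rewrite -addn1.
have Em' : m.+1%:Z = m%:Z + 1 by rewrite -addn1.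
transitivity (z ^ (- c) * qnum m.+2 *
   (\sum_(r < m.+3) (-1) ^+ r * z ^ (r%:Z * - m%:Z) * qbinom m.+1 r) +
   z ^ m.+2%:Z * qnum c *
   (\sum_(r < m.+3) (-1) ^+ r * z ^ (r%:Z * - m.+1%:Z) * qbinom m.+2 r)).
  rewrite !mulr_sumr -big_split; apply: eq_bigr => r _ /=.
  have := mul_qnum_qbinom_lower m.+2 r.
  have := mul_qnum_qbinom_pred m.+2 (r%:Z + 1).
  rewrite addrK => -> E.
  rewrite (_ : c + m.+2%:Z - r%:Z = m.+2%:Z - r%:Z + c); last by ring.
  rewrite qnumD (_ : 2 - m.+2%:Z = - m%:Z); last by rewrite Em Em'; ring.
  rewrite (_ : r%:Z * - m.+1%:Z = r%:Z * - m%:Z + - r%:Z);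
    last by rewrite Em'; ring.
  rewrite !(expfzDr _ _ z_neq0).
  rewrite (_ : m.+2%:Z - 1 = m.+1) in E; last by rewrite Em addrK.
  ring: E.
rewrite qbinom_altsum [X in _ * X + _]big_ord_recr /= qbinom_altsum.
by rewrite qbinom_small ?ltz_nat // !(mulr0, addr0).
Qed.

(** Reflecting the first binomial removes i from its upper index and cancels
    the sign; what remains is the q-Vandermonde identity with upper indices
    -b-2 and b+m, which add up to m-2 independently of b. *)
Lemma qbinom_serreF (t : nat) (m b : int) :
  \sum_(i < t.+1) (-1) ^+ i * z ^ (i%:Z * (2 - m)) *
      (qbinom (b + 1 + i%:Z) i * qbinom (b + m) (t%:Z - i%:Z))
    = z ^ ((b + 2) * t%:Z) * qbinom (m - 2) t.
Proof.
rewrite (_ : m - 2 = (- b - 2) + (b + m)); last by ring.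
rewrite -qbinom_vandermonde mulr_sumr; apply: eq_bigr => i _.
rewrite [qbinom (b + 1 + _) _]qbinom_negate.
rewrite (_ : i%:Z - 1 - (b + 1 + i%:Z) = - b - 2); last by ring.
rewrite (_ : i%:Z * (2 - m) = (b + 2) * t%:Z +
   ((- b - 2) * (t%:Z - i%:Z) - (b + m) * i%:Z)); last by ring.
have E : (-1) ^+ i * (-1) ^+ i = 1 :> L by rewrite -expr2 sqrr_sign.
rewrite (expfzDr _ _ z_neq0); ring: E.
Qed.

(** The same computation for the E-operators, where it is the second binomial
    that has to be reflected. *)
Lemma qbinom_serreE (t : nat) (m c : int) :
  \sum_(i < t.+1) (-1) ^+ i * z ^ (i%:Z * (2 - m)) *
      (qbinom (c + m - 1 - t%:Z) i * qbinom (c - i%:Z) (t%:Z - i%:Z))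
    = (-1) ^+ t * z ^ ((t%:Z + 1 - c - m) * t%:Z) * qbinom (m - 2) t.
Proof.
rewrite (_ : m - 2 = (c + m - 1 - t%:Z) + (t%:Z - 1 - c)); last by ring.
rewrite -qbinom_vandermonde mulr_sumr; apply: eq_bigr => i _.
have le_it : (i <= t)%N by rewrite leq_ord.
rewrite subzn // [qbinom (c - _) _]qbinom_negate -subzn //.
rewrite (_ : t%:Z - i%:Z - 1 - (c - i%:Z) = t%:Z - 1 - c); last by ring.
rewrite (_ : (-1) ^+ t = (-1) ^+ i * (-1) ^+ (t - i)); last by rewrite -exprD subnKC.
rewrite (_ : i%:Z * (2 - m) = (t%:Z + 1 - c - m) * t%:Z +
   ((c + m - 1 - t%:Z) * (t%:Z - i%:Z) - (t%:Z - 1 - c) * i%:Z)); last by ring.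
rewrite (expfzDr _ _ z_neq0); ring.
Qed.

End QuantumNumbers.

(** * Specialisation of Laurent polynomials *)

Lemma qbinE a b : qbin a b = qbinom _ qv a b. Proof. by []. Qed.

Lemma qv_neq0 : qv != 0.
Proof. by rewrite /qv tofrac_eq0 polyX_eq0. Qed.

Lemma qv_nroot n : qv ^+ n.+1 != 1.
Proof.
rewrite /qv -tofracXn -tofrac1 tofrac_eq; apply/eqP => /(congr1 (@size _ \o val)) /=.
by rewrite size_polyXn size_poly1.
Qed.

Definition laurent (x : {fraction {poly int}}) : Prop :=
  exists pn : {poly int} * nat, x = tofrac pn.1 / qv ^+ pn.2.

Section LaurentEval.
Variables (K : fieldType) (q : K).
Hypothesis q_neq0 : q != 0.

Lemma laurent_evalE p n :
  laurent_eval q (tofrac p / qv ^+ n) = (map_poly intr p).[q] / q ^+ n.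
Proof.
rewrite /laurent_eval; case: xgetP => [[p' n'] /= _|]; last first.
  by move/(_ (p, n)) => /=; case.
move/eqP; rewrite eqr_div ?expf_neq0 ?qv_neq0 // /qv -!tofracXn -!tofracM tofrac_eq.
move/eqP/(congr1 (fun p : {poly int} => (map_poly intr p : {poly K}).[q])).
rewrite !rmorphM /= !map_polyXn !hornerM !hornerXn => E.
by apply/eqP; rewrite eqr_div ?expf_neq0 // E.
Qed.

Lemma laurentD x y : laurent x -> laurent y ->
  laurent (x + y) /\ laurent_eval q (x + y) = laurent_eval q x + laurent_eval q y.
Proof.
move=> [[p n] /= ->] [[p' n'] /= ->].
have E : tofrac p / qv ^+ n + tofrac p' / qv ^+ n' =
    tofrac (p * 'X^n' + p' * 'X^n) / qv ^+ (n + n').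
  rewrite addf_div ?expf_neq0 ?qv_neq0 // exprD.
  by rewrite tofracD !tofracM !tofracXn.
split; first by exists (p * 'X^n' + p' * 'X^n, (n + n')%N).
rewrite E !laurent_evalE rmorphD !rmorphM /= !map_polyXn hornerD !hornerM !hornerXn.
by rewrite addf_div ?expf_neq0 // exprD.
Qed.

Lemma laurentM x y : laurent x -> laurent y ->
  laurent (x * y) /\ laurent_eval q (x * y) = laurent_eval q x * laurent_eval q y.
Proof.
move=> [[p n] /= ->] [[p' n'] /= ->].
have E : tofrac p / qv ^+ n * (tofrac p' / qv ^+ n') =
    tofrac (p * p') / qv ^+ (n + n').
  by rewrite mulf_div exprD tofracM.
split; first by exists (p * p', (n + n')%N).
by rewrite E !laurent_evalE rmorphM hornerM mulf_div exprD.
Qed.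

Lemma laurent_poly p : laurent (tofrac p) /\
  laurent_eval q (tofrac p) = (map_poly intr p).[q].
Proof.
have E : tofrac p = tofrac p / qv ^+ 0 by rewrite divr1.
by split; [exists (p, 0%N) | rewrite E laurent_evalE divr1].
Qed.

Lemma laurent0 : laurent 0 /\ laurent_eval q 0 = 0.
Proof.
by have := laurent_poly 0; rewrite tofrac0 rmorph0 horner0.
Qed.

Lemma laurent1 : laurent 1 /\ laurent_eval q 1 = 1.
Proof. by have := laurent_poly 1; rewrite tofrac1 rmorph1 hornerC. Qed.

Lemma laurentN1 n : laurent ((-1) ^+ n) /\ laurent_eval q ((-1) ^+ n) = (-1) ^+ n.
Proof.
have := laurent_poly ((-1) ^+ n).
rewrite rmorphXn rmorphN1 rmorphXn rmorphN1 => [[h ->]]; split=> //.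
by rewrite horner_exp hornerN hornerC.
Qed.

Lemma laurent_qv n : laurent (qv ^ n) /\ laurent_eval q (qv ^ n) = q ^ n.
Proof.
case: n => n.
  have := laurent_poly 'X^n; rewrite tofracXn map_polyXn hornerXn.
  by rewrite -!exprnP.
have E : qv ^ Negz n = tofrac 1 / qv ^+ n.+1 by rewrite tofrac1 div1r.
rewrite E; split; first by exists (1, n.+1).
by rewrite laurent_evalE rmorph1 hornerC div1r.
Qed.

Lemma laurent_sum (n : nat) (f : 'I_n -> {fraction {poly int}}) :
  (forall i, laurent (f i)) ->
  laurent (\sum_(i < n) f i) /\
  laurent_eval q (\sum_(i < n) f i) = \sum_(i < n) laurent_eval q (f i).
Proof.
move=> hf; elim: n f hf => [|n IH] f hf.
  by rewrite !big_ord0; exact: laurent0.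
rewrite !big_ord_recr /=; have [h <-] := IH _ (fun i => hf (widen_ord (leqnSn n) i)).
exact: laurentD.
Qed.

End LaurentEval.

(** Pascal's rule can be solved for either of its two terms with lower index
    b + 1, as their coefficients are units.  So integrality spreads from the
    upper index 0 to all integers, also to the negative ones. *)
Lemma laurent_qbin a b : laurent (qbin a b).
Proof.
have q1 : (1 : rat) != 0 by [].
have lD x y (lx : laurent x) (ly : laurent y) := proj1 (laurentD _ _ q1 _ _ lx ly).
have lM x y (lx : laurent x) (ly : laurent y) := proj1 (laurentM _ _ q1 _ _ lx ly).
have lv n : laurent (qv ^ n) := proj1 (@laurent_qv _ _ q1 n).
case: b => [b|b]; last exact: (proj1 (laurent0 _ _ q1)).
elim: b a => [|b IH] a; first by rewrite qbinE qbinom0; exact: (proj1 (laurent1 _ _ q1)).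
have Eb : b.+1%:Z = b%:Z + 1 by rewrite -addn1.
have P c := qbinom_pascal _ _ qv_neq0 qv_nroot c b.
elim/int_rect: a => [|n IHn|n IHn].
- rewrite qbinE qbinom_small //; exact: (proj1 (laurent0 _ _ q1)).
- rewrite -addn1 PoszD Eb qbinE P -Eb; apply: (lD); apply: (lM) => //.
- move: IHn; have := P (- n.+1%:Z).
  rewrite (_ : - n.+1%:Z + 1 = - n%:Z); last by rewrite -addn1 PoszD; ring.
  rewrite -Eb -!qbinE => E IHn.
  have -> : qbin (- n.+1%:Z) b.+1 =
     qv ^ (- b.+1%:Z) * (qbin (- n%:Z) b.+1 +
       (-1) ^+ 1 * (qv ^ (b%:Z - - n.+1%:Z) * qbin (- n.+1%:Z) b)).
    rewrite E expr1 mulN1r addrK mulrA -expfzDr ?qv_neq0 // addNr mul1r //.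
  apply: (lM) => //; apply: (lD) => //; apply: (lM); last exact: lM.
  exact: (proj1 (laurentN1 _ _ q1 1)).
Qed.

Section Specialisation.
Variables (K : fieldType) (q : K).
Hypothesis q_neq0 : q != 0.

Definition qbin_at (a b : int) : K := laurent_eval q (qbin a b).

Lemma qbin_at0 a : qbin_at a 0 = 1.
Proof. by rewrite /qbin_at qbinE qbinom0 (proj2 (laurent1 _ _ q_neq0)). Qed.

Lemma qbin_at_lt0 a b : b < 0 -> qbin_at a b = 0.
Proof.
by move=> b0; rewrite /qbin_at qbinE qbinom_lt0 // (proj2 (laurent0 _ _ q_neq0)).
Qed.

Lemma qbin_at_small (a b : int) : 0 <= a -> a < b -> qbin_at a b = 0.
Proof.
by move=> a0 ab; rewrite /qbin_at qbinE qbinom_small // (proj2 (laurent0 _ _ q_neq0)).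
Qed.

Let lD x y lx ly := proj1 (@laurentD _ _ q_neq0 x y lx ly).
Let lM x y lx ly := proj1 (@laurentM _ _ q_neq0 x y lx ly).
Let eM x y lx ly := proj2 (@laurentM _ _ q_neq0 x y lx ly).
Let lv n : laurent (qv ^ n) := proj1 (@laurent_qv _ _ q_neq0 n).
Let ev n := proj2 (@laurent_qv _ _ q_neq0 n).
Let ls n := proj1 (@laurentN1 _ _ q_neq0 n).
Let lb := laurent_qbin.
Let es n := proj2 (@laurentN1 _ _ q_neq0 n).
Let eS n f lf := proj2 (@laurent_sum _ _ q_neq0 n f lf).

Lemma qbin_at_sym (n r : nat) : (r <= n)%N -> qbin_at n r = qbin_at n (n%:Z - r%:Z).
Proof.
by move=> le_rn; rewrite /qbin_at qbinE (qbinom_sym _ _ qv_neq0 qv_nroot _ _ le_rn).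
Qed.

Lemma qbin_atN_1 a : qbin_at (- a) 1 = - qbin_at a 1.
Proof.
rewrite /qbin_at qbinE (@qbinom_negate _ _ qv_neq0 qv_nroot (- a) 1) opprK subrr add0r.
by rewrite -qbinE (eM _ _ (ls _) (lb _ _)) es expr1 mulN1r.
Qed.

Lemma qbin_at_saalschutz (r s t : nat) (a : int) :
  \sum_(i < t.+1) qbin_at (a - s%:Z) i * qbin_at (a + r%:Z - i%:Z) (t%:Z - i%:Z)
      * qbin_at (r%:Z + s%:Z - t%:Z) (r%:Z - i%:Z)
    = qbin_at (r%:Z + s%:Z) r * qbin_at a t.
Proof.
rewrite /qbin_at -eM; try exact: laurent_qbin.
rewrite !qbinE -(qbinom_saalschutz _ _ qv_neq0 qv_nroot) eS => [|i].
  apply: eq_bigr => i _.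
  by rewrite -!qbinE (eM _ _ (lM _ _ (lb _ _) (lb _ _)) (lb _ _)) (eM _ _ (lb _ _) (lb _ _)).
rewrite -!qbinE; exact: (lM _ _ (lM _ _ (lb _ _) (lb _ _)) (lb _ _)).
Qed.

Lemma qbin_at_serre_sum (m : nat) (c : int) : (1 < m)%N ->
  \sum_(r < m.+1) (-1) ^+ r * q ^ (r%:Z * (2 - m%:Z)) *
    (qbin_at (c + m%:Z - r%:Z) 1 * qbin_at m r) = 0.
Proof.
move=> /(@qbinom_serre_sum _ _ qv_neq0 qv_nroot m c).
move/(congr1 (laurent_eval q)); rewrite (proj2 (laurent0 _ _ q_neq0)) => S0; rewrite -[RHS]S0 {S0}.
have E a : qnum _ qv a = qbin a 1.
  have := mul_qnum_qbinom_lower _ _ qv_neq0 qv_nroot a 0.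
  by rewrite add0r qnum1 ?mul1r ?qbinom0 ?mulr1 ?subr0 //; [exact: qv_neq0|exact: qv_nroot].
have l r : laurent ((-1) ^+ r * qv ^ (r%:Z * (2 - m%:Z))).
  by apply: (lM); [exact: ls|exact: lv].
have l' r : laurent (qbin (c + m%:Z - r%:Z) 1 * qbin m r).
  by apply: (lM); exact: laurent_qbin.
rewrite eS => [|i]; last by rewrite E; apply: (lM).
apply: eq_bigr => r _.
rewrite E (eM _ _ (l _) (l' _)) (eM _ _ (ls _) (lv _)) es ev.
by rewrite (eM _ _ (lb _ _) (lb _ _)).
Qed.

Lemma qbin_at_serreF (t : nat) (m b : int) :
  \sum_(i < t.+1) (-1) ^+ i * q ^ (i%:Z * (2 - m)) *
      (qbin_at (b + 1 + i%:Z) i * qbin_at (b + m) (t%:Z - i%:Z))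
    = q ^ ((b + 2) * t%:Z) * qbin_at (m - 2) t.
Proof.
rewrite /qbin_at -ev -eM; [|exact: lv|exact: laurent_qbin].
rewrite !qbinE -(qbinom_serreF _ _ qv_neq0 qv_nroot) eS => [|i].
  apply: eq_bigr => i _; rewrite -!qbinE.
  rewrite (eM _ _ (lM _ _ (ls _) (lv _)) (lM _ _ (lb _ _) (lb _ _))).
  by rewrite (eM _ _ (ls _) (lv _)) (eM _ _ (lb _ _) (lb _ _)) es ev.
rewrite -!qbinE; exact: (lM _ _ (lM _ _ (ls _) (lv _)) (lM _ _ (lb _ _) (lb _ _))).
Qed.

Lemma qbin_at_serreE (t : nat) (m c : int) :
  \sum_(i < t.+1) (-1) ^+ i * q ^ (i%:Z * (2 - m)) *
      (qbin_at (c + m - 1 - t%:Z) i * qbin_at (c - i%:Z) (t%:Z - i%:Z))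
    = (-1) ^+ t * q ^ ((t%:Z + 1 - c - m) * t%:Z) * qbin_at (m - 2) t.
Proof.
rewrite /qbin_at -ev -es -eM; [|exact: ls|exact: lv].
rewrite -eM; [|apply: (lM); [exact: ls|exact: lv]|exact: laurent_qbin].
rewrite !qbinE -(qbinom_serreE _ _ qv_neq0 qv_nroot) eS => [|i].
  apply: eq_bigr => i _; rewrite -!qbinE.
  rewrite (eM _ _ (lM _ _ (ls _) (lv _)) (lM _ _ (lb _ _) (lb _ _))).
  by rewrite (eM _ _ (ls _) (lv _)) (eM _ _ (lb _ _) (lb _ _)) es ev.
rewrite -!qbinE; exact: (lM _ _ (lM _ _ (ls _) (lv _)) (lM _ _ (lb _ _) (lb _ _))).
Qed.

End Specialisation.

(** * Rearranging finite sums *)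

Lemma sum_range0 (W : nmodType) (a b : nat) (g : nat -> W) :
  (forall i, (a <= i < b)%N -> g i = 0) -> \sum_(a <= i < b) g i = 0.
Proof. by move=> g0; rewrite big_nat big1. Qed.

Lemma sum_trunc (W : nmodType) (n N : nat) (g : nat -> W) :
  (n <= N)%N -> (forall i, (n <= i)%N -> g i = 0) ->
  \sum_(i < N) g i = \sum_(i < n) g i.
Proof.
move=> le_nN g0; rewrite -!(big_mkord xpredT g) (big_cat_nat (n := n)) //=.
by rewrite [X in _ + X]sum_range0 ?addr0 // => i /andP[/g0].
Qed.

(** The double sums produced by moving an operator past two others are
    regrouped according to the total degree t removed from it. *)
Lemma sum_triangle (W : nmodType) (N : nat) (g : nat -> nat -> W) :
  (forall i j, (N <= i + j)%N -> g i j = 0) ->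
  \sum_(i < N) \sum_(j < N) g i j = \sum_(t < N) \sum_(i < t.+1) g i (t - i)%N.
Proof.
move=> g0.
transitivity (\sum_(i < N) \sum_(t < N | (i <= t)%N) g i (t - i)%N).
  apply: eq_bigr => i _; have le_iN := ltnW (ltn_ord i).
  rewrite -[RHS](big_mkord (leq i) (fun t => g i (t - i)%N)) -(big_mkord xpredT (g i)).
  rewrite (big_cat_nat (n := (N - i)%N)) ?leq_subr //=.
  have -> : \sum_(N - i <= j < N) g i j = 0.
    by apply: sum_range0 => j /andP[? _]; apply: g0; rewrite -leq_subLR.
  rewrite addr0 [RHS](big_cat_nat (n := i)) //=.
  rewrite [X in _ = X + _]big_nat_cond [X in _ = X + _]big1 ?add0r; last first.
    by move=> t /andP[/andP[_ lt_ti] /(leq_trans lt_ti)]; rewrite ltnn.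
  rewrite [RHS](big_addn 0 N i).
  by apply: eq_big => t; rewrite ?leq_addl // addnK.
rewrite (exchange_big_dep xpredT) //=; apply: eq_bigr => t _.
rewrite (big_ord_widen_cond N xpredT (fun i => g i (t - i)%N)) //.
Qed.

Lemma sum_shift (W : nmodType) (N i : nat) (g : nat -> W) :
  (forall r, (r < i)%N -> g r = 0) -> (forall r, (N <= r)%N -> g r = 0) ->
  \sum_(r < N) g r = \sum_(p < N) g (p + i)%N.
Proof.
move=> g0 g1; rewrite -(big_mkord xpredT g) -(big_mkord xpredT (fun p => g (p + i)%N)).
transitivity (\sum_(0 <= r < N + i) g r).
  rewrite [RHS](big_cat_nat (n := N)) ?leq_addr //=.
  by rewrite [X in _ + X]sum_range0 ?addr0 // => r /andP[/g1].
rewrite (big_cat_nat (n := i)) ?leq_addl //= sum_range0 ?add0r; last first.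
  by move=> r /andP[_ /g0].
by rewrite (big_addn 0 (N + i) i) addnK.
Qed.

(** T x y t stands for the word with outer exponents x, y in which degree t has
    been taken away from the operator that was moved.  The hypothesis on w says
    that, along words with the same first exponent p, the coefficients add up to
    a quantity depending on p only through q^(p t).  This twist is exactly the
    change from the sign-power weights of degree m to those of degree m - t. *)
Lemma serre_regroup (K : fieldType) (q : K) (W : lmodType K) (m k : nat)
    (w : nat -> nat -> nat -> K) (C : nat -> K) (T : int -> int -> nat -> W) :
  q != 0 ->
  (forall x y t, x < 0 -> T x y t = 0) -> (forall x y t, y < 0 -> T x y t = 0) ->
  (forall x y t, (k < t)%N -> T x y t = 0) ->
  (forall p t, \sum_(i < t.+1) (-1) ^+ i * q ^ (i%:Z * (2 - m%:Z)) *
       w (p + i)%N i (t - i)%N = C t * q ^ (p%:Z * t%:Z)) ->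
  \sum_(r < m.+1) ((-1) ^+ r * q ^ (r%:Z * (2 - m%:Z))) *:
     \sum_(i < k.+1) \sum_(j < k.+1)
        w r i j *: T (r%:Z - i%:Z) (m%:Z - r%:Z - j%:Z) (i + j)%N =
  \sum_(t < k.+1) C t *: \sum_(p < m.+1)
     ((-1) ^+ p * q ^ (p%:Z * (2 - (m%:Z - t%:Z)))) *: T p (m%:Z - t%:Z - p%:Z) t.
Proof.
move=> q0 Tx Ty Tt Hw.
transitivity (\sum_(r < m.+1) \sum_(t < k.+1) \sum_(i < t.+1)
   ((-1) ^+ r * q ^ (r%:Z * (2 - m%:Z))) *: (w r i (t - i)%N *:
     T (r%:Z - i%:Z) (m%:Z - r%:Z - (t - i)%N%:Z) (i + (t - i))%N)).
  apply: eq_bigr => r _; rewrite (@sum_triangle _ _ (fun i j =>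
    w r i j *: T (r%:Z - i%:Z) (m%:Z - r%:Z - j%:Z) (i + j)%N)).
    by rewrite scaler_sumr; apply: eq_bigr => t _; rewrite scaler_sumr.
  by move=> i j ?; rewrite Tt ?scaler0.
rewrite exchange_big /=; apply: eq_bigr => t _.
rewrite exchange_big /= scaler_sumr.
transitivity (\sum_(i < t.+1) \sum_(p < m.+1) ((-1) ^+ (p + i) *
   q ^ ((p + i)%N%:Z * (2 - m%:Z))) *: (w (p + i)%N i (t - i)%N *: T p (m%:Z - t%:Z - p%:Z) t)).
  apply: eq_bigr => i _; have le_it := leq_ord i.
  pose g r := ((-1) ^+ r * q ^ (r%:Z * (2 - m%:Z))) *: (w r i (t - i)%N *:
     T (r%:Z - i%:Z) (m%:Z - r%:Z - (t - i)%N%:Z) (i + (t - i))%N).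
  rewrite (@sum_shift _ m.+1 i g) => [|r lt_ri|r lt_mr].
  - apply: eq_bigr => p _; rewrite /g subnKC // -subzn //.
    by congr (_ *: (_ *: T _ _ _)); rewrite PoszD; ring.
  - by rewrite /g Tx ?scaler0 // subr_lt0.
  - rewrite /g Ty ?scaler0 //; lia.
rewrite exchange_big; apply: eq_bigr => p _ /=.
under eq_bigr => i _ do rewrite scalerA.
rewrite -scaler_suml !scalerA; congr (_ *: _).
rewrite (_ : p%:Z * (2 - (m%:Z - t%:Z)) = p%:Z * (2 - m%:Z) + p%:Z * t%:Z); last by ring.
rewrite expfzDr // (_ : C t * _ = (-1) ^+ p * q ^ (p%:Z * (2 - m%:Z)) * (C t * q ^ (p%:Z * t%:Z)));
  last by ring.
rewrite -Hw mulr_sumr; apply: eq_bigr => i _.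
by rewrite PoszD mulrDl expfzDr // exprD; ring.
Qed.

Section SerreCombination.
Variables (K : fieldType) (q : K) (W : lmodType K).

(** The left hand side of the Serre relation of degree m, when T x y is the word
    with outer exponents x and y. *)
Definition serre_comb (m : nat) (T : int -> int -> W) : W :=
  \sum_(p < m.+1) ((-1) ^+ p * q ^ (p%:Z * (2 - m%:Z))) *: T p (m%:Z - p%:Z).

(** Serre combinations of degree m - t are known to vanish only for
    m - t > 1; the factor [m-2 choose t] takes care of the other t. *)
Lemma serre_vanish (m k : nat) (w : nat -> nat -> nat -> K) (D : nat -> K)
    (T : int -> int -> nat -> W) :
  q != 0 -> (1 < m)%N ->
  (forall x y t, x < 0 -> T x y t = 0) -> (forall x y t, y < 0 -> T x y t = 0) ->
  (forall x y t, (k < t)%N -> T x y t = 0) ->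
  (forall p t, \sum_(i < t.+1) (-1) ^+ i * q ^ (i%:Z * (2 - m%:Z)) *
       w (p + i)%N i (t - i)%N = D t * q ^ (p%:Z * t%:Z) * qbin_at _ q (m%:Z - 2) t) ->
  (forall n t, (t <= k)%N -> (n + t)%N = m -> (1 < n)%N ->
     serre_comb n (fun x y => T x y t) = 0) ->
  serre_comb m (fun x y => \sum_(i < k.+1) \sum_(j < k.+1)
     w `|x|%N i j *: T (x - i%:Z) (y - j%:Z) (i + j)%N) = 0.
Proof.
move=> q0 m1 Tx Ty Tt Hw T0; rewrite /serre_comb.
have := @serre_regroup K q W m k w (fun t => D t * qbin_at _ q (m%:Z - 2) t) T q0 Tx Ty Tt.
rewrite /= => -> => [|p t]; last by rewrite Hw mulrAC.
rewrite big1 // => t _; case: (ltnP (m - 2) t) => [lt_mt|le_tm].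
  by rewrite qbin_at_small ?mulr0 ?scale0r //; lia.
have le_t := leq_trans le_tm (leq_subr 2 m).
have := T0 (m - t)%N t (leq_ord t) (subnK le_t).
rewrite /serre_comb => E; rewrite -[RHS](scaler0 _ (D t * qbin_at _ q (m%:Z - 2) t)).
congr (_ *: _); rewrite -[RHS]E; last by lia.
pose f (p : nat) := ((-1) ^+ p * q ^ (p%:Z * (2 - (m%:Z - t%:Z)))) *:
  T p (m%:Z - t%:Z - p%:Z) t.
transitivity (\sum_(p < m.+1) f p); first by [].
rewrite (@sum_trunc _ (m - t).+1 m.+1 f); first last.
- by move=> p lt_p; rewrite /f Ty ?scaler0 //; lia.
- by rewrite ltnS leq_subr.
by apply: eq_bigr => p _; rewrite /f subzn.
Qed.

End SerreCombination.

Arguments serre_comb {K} q {W} m T.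

Lemma fsbig_int_nat (W : nmodType) (N : nat) (f : int -> W) :
  (forall r, r < 0 -> f r = 0) -> (forall r, N%:Z <= r -> f r = 0) ->
  \sum_(r \in [set: int]) f r = \sum_(r < N) f r%:Z.
Proof.
move=> f0 f1; rewrite -(big_mkord xpredT (fun r : nat => f r)).
rewrite (@fsbigE _ _ _ _ _ [seq Posz i | i <- iota 0 N]).
- rewrite big_map /index_iota subn0; apply: eq_bigl => i.
  exact/mem_set.
- by rewrite map_inj_uniq ?iota_uniq // => i j [].
- by [].
- case=> r _ hr; last exact: f0.
  apply: f1; rewrite lez_nat leqNgt; apply: contra hr => lt_rN.
  by rewrite mem_map ?mem_iota // => i j [].
Qed.

(** * Simple roots and weights *)

Section Roots.
Variables (F : archiRealFieldType) (V : vectType F) (R : root_system V).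
Variable (Pi : root_base R).
Implicit Types (a b : simple_root Pi) (mu : weight R).

Lemma root_simple a : ssval a \in Defs.roots R.
Proof. exact: base_roots (ssvalP a). Qed.

Lemma pairing_val mu a : (pairing mu a)%:~R = coroot R (ssval a) (wval mu) :> F.
Proof.
rewrite /pairing Num.Theory.floorK //.
by have /allP/(_ _ (root_simple a)) := valP mu.
Qed.

Lemma wvalD mu nu : wval (mu + nu) = wval mu + wval nu.
Proof. exact: (raddfD (\val : weight R -> V)). Qed.

Lemma wval_mulz mu n : wval (mu *~ n) = wval mu *~ n.
Proof. exact: (raddfMz (\val : weight R -> V)). Qed.

Lemma pairing_shift mu b n a :
  pairing (mu + sroot b *~ n) a = pairing mu a + pairing (sroot b) a * n.
Proof.
apply: (@intr_inj F); rewrite rmorphD rmorphM /= !pairing_val wvalD wval_mulz.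
by rewrite linearD /= raddfMz /= mulrzr.
Qed.

Lemma pairing_self a : pairing (sroot a) a = 2.
Proof.
apply: (@intr_inj F); rewrite pairing_val /= coroot_root //.
exact: root_simple.
Qed.

Definition base_coord (x : V) (a : simple_root Pi) : F :=
  coord (in_tuple (base Pi)) (Ordinal (etrans (index_mem _ _) (ssvalP a))) x.

Lemma base_coordE a b : base_coord (ssval b) a = (a == b)%:R.
Proof.
rewrite /base_coord -{1}(nth_index 0 (ssvalP b)).
have := @coord_free _ _ _ (in_tuple (base Pi))
  (Ordinal (etrans (index_mem _ _) (ssvalP b)))
  (Ordinal (etrans (index_mem _ _) (ssvalP a))) (base_free Pi).
move=> /= ->; congr (nat_of_bool _)%:R.
rewrite -val_eqE /= eq_sym; apply/eqP/eqP => [E|-> //]; apply: val_inj => /=.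
by rewrite -(nth_index 0 (ssvalP a)) E nth_index // ssvalP.
Qed.

Lemma root_coord_sign x a b : x \in Defs.roots R ->
  0 < base_coord x a -> 0 <= base_coord x b.
Proof.
case/(@base_gen _ _ _ Pi) => c.
have E d : 0 <= base_coord (\sum_(y <- base Pi) y *+ c y) d.
  rewrite /base_coord linear_sum big_seq sumr_ge0 // => y y_base.
  rewrite raddfMn mulrn_wge0 //.
  by have := base_coordE d (SeqSub y_base); rewrite /base_coord /= => ->.
case=> ->; rewrite ?E //.
by rewrite /base_coord linearN oppr_gt0 => /(le_lt_trans (E a)); rewrite ltxx.
Qed.

Hypothesis Pi_sl : simply_laced Pi.

(** The only case to exclude is <c, d^vee> = 0 and <d, c^vee> = -1.  Reflecting
    d in c would give the root c + d, and reflecting this in d the root c - d,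
    whose coordinates have mixed signs. *)
Lemma pairing_sym a b : a != b -> pairing (sroot a) b = pairing (sroot b) a.
Proof.
move=> ab.
suff H (c d : simple_root Pi) : c != d -> pairing (sroot c) d = 0 ->
    pairing (sroot d) c = -1 -> False.
  have ba : b != a by rewrite eq_sym.
  have [E1|E1] := Pi_sl _ _ ab; have [E2|E2] := Pi_sl _ _ ba; rewrite E1 E2 //.
    by case: (H a b).
  by case: (H b a).
move=> cd; move/(congr1 (intr : int -> F)); rewrite pairing_val /= => Ec.
move/(congr1 (intr : int -> F)); rewrite pairing_val /= => Ed.
have := roots_refl (root_simple c) (root_simple d).
rewrite Ed mulrN1z scaleN1r opprK => /(roots_refl (root_simple d)).
rewrite linearD /= Ec coroot_root ?root_simple // addr0.
rewrite (_ : _ - _ = ssval c - ssval d); last first.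
  by rewrite scaler_nat mulr2n opprD addrA addrAC addrN add0r.
have bc e : base_coord (ssval c - ssval d) e = (e == c)%:R - (e == d)%:R.
  by rewrite -!base_coordE /base_coord linearB.
move=> /(@root_coord_sign _ c d); rewrite !bc !eqxx (negPf cd) eq_sym (negPf cd).
by rewrite subr0 sub0r ltr01 oppr_ge0 ler10 => /(_ isT).
Qed.

Definition height (x : V) : F := \sum_a base_coord x a.

Lemma heightD x y : height (x + y) = height x + height y.
Proof.
by rewrite -big_split; apply: eq_bigr => a _; rewrite /base_coord linearD.
Qed.

Lemma height_simple a : height (ssval a) = 1.
Proof.
rewrite /height (bigD1 a) //= base_coordE eqxx big1 ?addr0 // => b ba.
by rewrite base_coordE (negPf ba).
Qed.

Lemma height_sum mu (s : seq (simple_root Pi)) :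
  height (wval (mu + \sum_(a <- s) sroot a)) = height (wval mu) + (size s)%:R.
Proof.
elim: s => [|a s IH]; first by rewrite big_nil !addr0.
by rewrite big_cons addrCA wvalD heightD IH height_simple addrCA -natr1 [_ + 1]addrC.
Qed.

(** Every simple root adds 1 to the height, and a finite set of weights has
    bounded height. *)
Lemma weight_bounded (T : set (weight R)) mu : quasi_bounded Pi T ->
  exists N : nat, forall s : seq (simple_root Pi), (N <= size s)%N ->
    ~ T (mu + \sum_(a <- s) sroot a).
Proof.
move/(_ mu)/finite_seqP => [l El].
pose B (x : weight R) := Num.bound (height (wval x) - height (wval mu)).
exists (\max_(x <- l) B x).+1 => s le_s Ts.
set x := mu + _ in Ts; have xl : x \in l.
  have : [set lambda | T lambda /\ wle Pi mu lambda]%classic x.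
    by split=> //; exists s; rewrite addrC addKr.
  by rewrite El.
have := leq_trans (leq_ltn_trans (@leq_bigmax_seq _ l xpredT B x xl isT) (ltnSn _)) le_s.
rewrite /B height_sum addrC addKr ltnNge -(ler_nat F).
by rewrite ltW // archi_boundP // ler0n.
Qed.

End Roots.

(** * Operators, weight spaces and induction principles *)

Section Relations.
Variables (F : archiRealFieldType) (V : vectType F) (R : root_system V).
Variable (Pi : root_base R).
Variables (K : fieldType) (q : K).
Hypothesis q_neq0 : q != 0.
Variable M : objX Pi q.
Implicit Types (a b c : simple_root Pi) (mu nu : weight R) (u v : M).

Local Notation E a n := (@opE _ _ _ _ _ M a n).
Local Notation F_ a n := (@opF _ _ _ _ _ M a n).
Local Notation "mu .-space" := (wspace M mu) (at level 2, format "mu .-space").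
Local Notation qbin_at := (qbin_at K q).

Lemma wspace0 mu : 0 \in mu.-space.
Proof. by case: (wspace_sub M mu). Qed.

Lemma wspaceD mu u v : u \in mu.-space -> v \in mu.-space -> u + v \in mu.-space.
Proof. by case: (wspace_sub M mu) => _ H hu hv; rewrite -[u]scale1r; exact: H. Qed.

Lemma wspaceZ mu (x : K) u : u \in mu.-space -> x *: u \in mu.-space.
Proof.
by case: (wspace_sub M mu) => H0 H hu; rewrite -[_ *: _]addr0; exact: H.
Qed.

Lemma wspace_sum mu (n : nat) (f : 'I_n -> M) :
  (forall i, f i \in mu.-space) -> \sum_(i < n) f i \in mu.-space.
Proof.
move=> hf; elim/big_ind: _ => [|x y hx hy|i _]; [exact: wspace0|exact: wspaceD|exact: hf].
Qed.

Lemma wspace_ext (P : M -> Prop) :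
  P 0 -> (forall u v, P u -> P v -> P (u + v)) ->
  (forall mu v, v \in mu.-space -> P v) -> forall v, P v.
Proof.
move=> P0 PD Pw v; have [s [f [hf ->]]] := wspace_span v.
by elim/big_ind: _ => // mu _; exact: Pw (hf mu).
Qed.

Lemma E_wspace mu a n v : v \in mu.-space -> E a n v \in (mu + sroot a *~ n).-space.
Proof.
move=> hv; case: (ltrgtP n 0) => [n0|n0|->].
- by rewrite opE_neg //; exact: wspace0.
- exact: opE_deg.
- by rewrite opE0 mulr0z addr0.
Qed.

Lemma F_wspace mu a n v : v \in mu.-space -> F_ a n v \in (mu - sroot a *~ n).-space.
Proof.
move=> hv; case: (ltrgtP n 0) => [n0|n0|->].
- by rewrite opF_neg //; exact: wspace0.
- by apply: opF_deg => //; rewrite subrK.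
- by rewrite opF0 mulr0z subr0.
Qed.

(** The bound N may be any number above one of the two degrees; having it free
    lets nested applications share the same range of summation. *)
Lemma EF_same nu a (k n : int) (N : nat) v : v \in nu.-space ->
  k < N%:Z \/ n < N%:Z ->
  E a k (F_ a n v) = \sum_(i < N) qbin_at (pairing nu a - n + k) i *:
     F_ a (n - i%:Z) (E a (k - i%:Z) v).
Proof.
move=> hv hN.
have hvan (r : int) : N%:Z <= r -> forall x, x *: F_ a (n - r) (E a (k - r) v) = 0.
  move=> le_Nr x; case: hN => hN.
    by rewrite opE_neg ?linear0 ?scaler0 //; lia.
  by rewrite opF_neg ?scaler0 //; lia.
have zero : E a k (F_ a n v) = 0 -> (forall i : nat, 
    F_ a (n - i%:Z) (E a (k - i%:Z) v) = 0) -> E a k (F_ a n v) =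
    \sum_(i < N) qbin_at (pairing nu a - n + k) i *:
     F_ a (n - i%:Z) (E a (k - i%:Z) v).
  by move=> -> H; rewrite big1 // => i _; rewrite H scaler0.
have [k0|k0] : k < 0 \/ 0 <= k by lia.
  by apply: zero => [|i]; rewrite opE_neg ?linear0 //; lia.
have [n0|n0] : n < 0 \/ 0 <= n by lia.
  by apply: zero => [|i]; rewrite opF_neg ?linear0 //; lia.
have N0 : 0 <= n -> 0 <= k -> (0 < N)%N by case: hN; lia.
have {}N0 := N0 n0 k0.
have [En|n_gt0] : n = 0 \/ 0 < n by lia.
  rewrite En; case: N N0 {hN hvan zero} => // N _.
  rewrite big_ord_recl !subr0 qbin_at0 // scale1r !opF0 big1 ?addr0 // => i _.
  by rewrite opF_neg ?scaler0 // lift0; lia.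
have [Ek|k_gt0] : k = 0 \/ 0 < k by lia.
  rewrite Ek; case: N N0 {hN hvan zero} => // N _.
  rewrite big_ord_recl !subr0 qbin_at0 // scale1r !opE0 big1 ?addr0 // => i _.
  by rewrite opE_neg ?linear0 ?scaler0 // lift0; lia.
have X2 : axiomX2 q M := @objX_X2 _ _ _ _ _ _ M.
have := X2 (nu - sroot a *~ n) a a k n v k_gt0 n_gt0.
rewrite subrK hv => /(_ isT)[_ /(_ erefl)->].
rewrite (fsbig_int_nat _ N) => [|r r0|r /hvan ->] //.
  apply: eq_bigr => i _; rewrite -mulrNz pairing_shift pairing_self.
  by congr (qbin_at _ _ *: _); ring.
by rewrite -/(qbin_at _ _) qbin_at_lt0 // scale0r.
Qed.

Lemma EF_diff a b (k n : int) v : a != b -> E a k (F_ b n v) = F_ b n (E a k v).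
Proof.
move=> ab; move: v; apply: wspace_ext => [|u v hu hv|mu v hv].
- by rewrite !linear0.
- by rewrite !linearD hu hv.
have [n0|[->|n_gt0]] : n < 0 \/ n = 0 \/ 0 < n by lia.
- by rewrite !opF_neg // linear0.
- by rewrite !opF0.
have [k0|[->|k_gt0]] : k < 0 \/ k = 0 \/ 0 < k by lia.
- by rewrite !opE_neg // linear0.
- by rewrite !opE0.
have X2 : axiomX2 q M := @objX_X2 _ _ _ _ _ _ M.
have := X2 (mu - sroot b *~ n) a b k n v k_gt0 n_gt0.
by rewrite subrK hv => /(_ isT)[/(_ ab)-> _].
Qed.

(** Induction on the number of simple roots that can still be added before
    leaving the weights of M. *)
Lemma weight_ind (P : M -> Prop) :
  P 0 ->
  (forall mu v, v \in mu.-space ->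
     (forall a (n : int), 0 < n -> forall u, u \in (mu + sroot a *~ n).-space -> P u) ->
     P v) ->
  forall mu v, v \in mu.-space -> P v.
Proof.
move=> P0 step mu; have [bnd _] := objX_X1 M.
have [N] := weight_bounded _ _ _ _ _ mu bnd.
elim: N mu => [|N IH] mu hN v hv.
  suff -> : v = 0 by [].
  apply/eqP; apply: contra_notT (hN [::] isT) => v0; exists v => //.
  by rewrite big_nil addr0.
apply: (step mu v hv) => a [n|//] n0 u; apply: IH => s le_s.
rewrite (_ : _ + _ = mu + \sum_(b <- nseq n a ++ s) sroot b); last first.
  by rewrite big_cat big_nseq iter_addr_0 addrA.
apply: hN; rewrite size_cat size_nseq; case: n n0 => // n _.
by rewrite addSn ltnS (leq_trans le_s) // leq_addl.
Qed.

(** The induction principle for F-relations of degree n.  Moving E^(k) past a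
    word of degree n takes away i from both; for i < k the remaining operator
    raises the weight, for i = k the degree has dropped. *)
Lemma F_ind (P : nat -> M -> Prop) :
  (forall n, P n 0) ->
  (forall mu v n, v \in mu.-space ->
     (forall a (k i n' : nat), (0 < k)%N -> (i <= k)%N -> (n' + i)%N = n ->
        P n' (E a (k%:Z - i%:Z) v)) -> P n v) ->
  forall mu v, v \in mu.-space -> forall n, P n v.
Proof.
move=> P0 step; apply: weight_ind => // mu v hv IH n.
elim/ltn_ind: n => n IHn; apply: (step _ _ _ hv) => a k i n' k0 le_ik En.
have [Eik|lt_ik] : i = k \/ (i < k)%N by lia.
  by rewrite Eik subrr opE0; apply: IHn; lia.
by apply: (IH a (k%:Z - i%:Z)); [lia | exact: E_wspace].
Qed.

Lemma imF_add mu u v : imF M mu u -> imF M mu v -> imF M mu (u + v).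
Proof.
move=> [N1 [w1 [h1 ->]]] [N2 [w2 [h2 ->]]].
pose pad (N : nat) (w : simple_root Pi -> nat -> M) a n :=
  if (n < N)%N then w a n else 0.
have padE N N' w : (N <= N')%N ->
    \sum_(a : simple_root Pi) \sum_(1 <= n < N) opF a n%:Z (w a n) =
    \sum_(a : simple_root Pi) \sum_(1 <= n < N') opF a n%:Z (pad N w a n).
  move=> le_N; apply: eq_bigr => a _.
  case: N le_N => [|N] le_N.
    rewrite big_geq // sum_range0 // => i _; exact: linear0.
  rewrite (@big_cat_nat _ _ _ N.+1 1 N') //= [X in _ = _ + X]sum_range0 ?addr0.
    by rewrite !big_nat; apply: eq_bigr => i /andP[_ lt_i]; rewrite /pad lt_i.
  by move=> i /andP[le_i _]; rewrite /pad ltnNge le_i linear0.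
exists (maxn N1 N2), (fun a n => pad N1 w1 a n + pad N2 w2 a n); split.
  move=> a n /andP[n0 _]; apply: wspaceD; rewrite /pad.
    by case: ifP => ?; [apply: h1; rewrite n0|exact: wspace0].
  by case: ifP => ?; [apply: h2; rewrite n0|exact: wspace0].
rewrite (padE _ (maxn N1 N2) w1) ?leq_maxl // (padE _ (maxn N1 N2) w2) ?leq_maxr //.
rewrite -big_split; apply: eq_bigr => a _ /=; rewrite -big_split.
by apply: eq_bigr => n _; rewrite /= linearD.
Qed.

Lemma imF0 mu : imF M mu 0.
Proof.
exists 0%N, (fun _ _ => 0); split=> [a n|]; first by rewrite andbF.
by rewrite big1 // => a _; rewrite big_geq.
Qed.

Lemma imF_scale mu (x : K) u : imF M mu u -> imF M mu (x *: u).
Proof.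
move=> [N [w [hw ->]]]; exists N, (fun a n => x *: w a n); split.
  by move=> a n h; apply: wspaceZ; apply: hw.
rewrite scaler_sumr; apply: eq_bigr => a _; rewrite scaler_sumr.
by apply: eq_bigr => n _; rewrite linearZ.
Qed.

Lemma imF_sum mu (n : nat) (f : 'I_n -> M) :
  (forall i, imF M mu (f i)) -> imF M mu (\sum_(i < n) f i).
Proof.
move=> hf; elim/big_ind: _ => [|x y hx hy|i _]; [exact: imF0|exact: imF_add|exact: hf].
Qed.

Lemma imF_F mu a (n : nat) u : (0 < n)%N -> u \in (mu + sroot a *~ n%:Z).-space ->
  imF M mu (F_ a n u).
Proof.
move=> n0 hu.
exists n.+1, (fun c i => if (c == a) && (i == n) then u else 0); split.
  move=> c i _; case: ifP => [/andP[/eqP-> /eqP->] //|_]; exact: wspace0.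
rewrite (bigD1 a) //= [X in _ + X]big1 ?addr0 => [|c /negPf ca]; last first.
  by rewrite big1 // => i _; rewrite ca linear0.
rewrite big_nat_recr //= !eqxx /= sum_range0 ?add0r // => i /andP[_ lt_in].
by rewrite (ltn_eqF lt_in) linear0.
Qed.

(** The half of axiomX3 saying that the sum is direct. *)
Lemma ker_im mu (w : M) : w \in mu.-space -> imF M mu w ->
  (forall a (k : nat), (0 < k)%N -> E a k w = 0) -> w = 0.
Proof.
move=> hw him hE; apply: (proj2 (objX_X3 M mu)) => //; split=> //.
by move=> a [n|//] n0; exact: hE.
Qed.

(** The induction principle for E-relations, from the half of axiomX3 saying that
    ker E and im F span. *)
Lemma E_ind (P : M -> Prop) :
  (forall u v, P u -> P v -> P (u + v)) ->
  (forall mu v, kerE M mu v -> P v) ->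
  (forall mu a (n : nat) u, (0 < n)%N -> u \in mu.-space -> P u -> P (F_ a n u)) ->
  forall mu v, v \in mu.-space -> P v.
Proof.
move=> PD Pk Pf.
have P0 : P 0.
  by apply: (Pk 0); split=> [|a n _]; [exact: wspace0 | rewrite linear0].
apply: weight_ind => // mu v hv IH.
have [k [i [hk [N [w [hw ->]]] ->]]] := proj1 (objX_X3 M mu) v hv.
apply: (PD); first exact: Pk hk.
apply: (big_ind P P0) => [|a _]; first exact: PD.
rewrite big_nat_cond; apply: (big_ind P P0) => [|n]; first exact: PD.
move=> /andP[/andP[n0 lt_nN] _].
have hwn : w a n \in (mu + sroot a *~ n).-space by apply: hw; rewrite n0.
by apply: (Pf _ _ _ _ n0 hwn); apply: (IH a n) hwn.
Qed.

(** * Relations between the F-operators *)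

Lemma F_imF nu a (n : nat) v : (0 < n)%N -> v \in nu.-space ->
  imF M (nu - sroot a *~ n) (F_ a n v).
Proof. by move=> n0 hv; apply: imF_F => //; rewrite subrK. Qed.

(** The rule for divided powers.  It is not part of the axioms; for q not a
    root of unity it says that F^(n) is F^n / [n]!. *)
Lemma F_divpow nu a v : v \in nu.-space -> forall r s : nat,
  F_ a r (F_ a s v) = qbin_at (r%:Z + s%:Z) r *: F_ a (r%:Z + s%:Z) v.
Proof.
move=> hv r s.
pose P (n : nat) (v : M) := forall r s : nat, (r + s)%N = n ->
  F_ a r (F_ a s v) = qbin_at (r%:Z + s%:Z) r *: F_ a (r%:Z + s%:Z) v.
suff : P (r + s)%N v by apply.
move: nu v hv (r + s)%N; apply: F_ind => {r s} [n r s _|nu v n hv IH r s En].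
  by rewrite !linear0.
have [Es|s0] : s = 0%N \/ (0 < s)%N by lia.
  by rewrite Es opF0 addr0 qbin_at_sym // subrr qbin_at0 // scale1r.
have Ers : (r%:Z + s%:Z) = (r + s)%N by rewrite PoszD.
have wE : nu - sroot a *~ s - sroot a *~ r = nu - sroot a *~ (r%:Z + s%:Z).
  by rewrite mulrzDr opprD addrA addrAC.
apply/eqP; rewrite -subr_eq0; apply/eqP; apply: (ker_im (nu - sroot a *~ (r%:Z + s%:Z))).
- rewrite -scaleN1r; apply: wspaceD; last by do 2!apply: wspaceZ; exact: F_wspace.
  by rewrite -wE; do 2!apply: F_wspace.
- rewrite -scaleN1r; apply: imF_add; last first.
    by do 2!apply: imF_scale; rewrite Ers; apply: F_imF; rewrite ?addn_gt0 ?s0 ?orbT.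
  have [Er|r0] : r = 0%N \/ (0 < r)%N by lia.
    by rewrite Er opF0 add0r; exact: F_imF.
  by rewrite -wE; apply: F_imF => //; exact: F_wspace.
move=> c k k0; rewrite linearB linearZ /=; apply/eqP; rewrite subr_eq0; apply/eqP.
(* Operators of another simple root commute with F_a: the relation for E v. *)
case: (eqVneq c a) => [->|ca]; last first.
  rewrite !(EF_diff c a) //.
  by have := IH c k 0%N n k0 isT (addn0 n); rewrite subr0 => /(_ _ _ En).
rewrite (EF_same _ _ _ _ k.+1 _ (F_wspace _ a s v hv)); last by left; lia.
rewrite (EF_same _ _ _ _ k.+1 _ hv); last by left; lia.
rewrite -mulrNz pairing_shift pairing_self.
pose g (i j : nat) := (qbin_at (pairing nu a + 2 * - s%:Z - r%:Z + k%:Z) i *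
   qbin_at (pairing nu a - s%:Z + (k%:Z - i%:Z)) j) *:
   F_ a (r%:Z - i%:Z) (F_ a (s%:Z - j%:Z) (E a (k%:Z - (i + j)%N%:Z) v)).
transitivity (\sum_(i < k.+1) \sum_(j < k.+1) g i j).
  apply: eq_bigr => i _; rewrite (EF_same _ _ _ _ k.+1 _ hv); last by left; lia.
  rewrite linear_sum scaler_sumr; apply: eq_bigr => j _; rewrite linearZ scalerA.
  by rewrite /g (_ : k%:Z - (i + j)%N%:Z = k%:Z - i%:Z - j%:Z) // PoszD; ring.
rewrite (sum_triangle _ _ g); last first.
  by move=> i j lt_k; rewrite /g opE_neg ?linear0 ?scaler0 //; lia.
rewrite scaler_sumr; apply: eq_bigr => t _; have le_tk := leq_ord t.
rewrite scalerA -qbin_at_saalschutz // scaler_suml; apply: eq_bigr => i _.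
have le_it := leq_ord i.
rewrite /g subnKC // -[in RHS]scalerA.
rewrite (_ : pairing nu a + 2 * - s%:Z - r%:Z + k%:Z =
  pairing nu a - (r%:Z + s%:Z) + k%:Z - s%:Z); last by ring.
rewrite (_ : pairing nu a - s%:Z + (k%:Z - i%:Z) =
  pairing nu a - (r%:Z + s%:Z) + k%:Z + r%:Z - i%:Z); last by ring.
rewrite -(subzn le_it); congr (_ *: _).
(* Where an exponent is negative the left hand side vanishes; so does the right
   hand side, through its binomial or, for r + s < t, through its operator. *)
have [lt_ri|le_ir] := ltnP r i.
  by rewrite opF_neg ?qbin_at_lt0 ?scale0r //; lia.
have [lt_s|le_s] : (s < t - i)%N \/ (t - i <= s)%N by lia.
  rewrite [F_ a (s%:Z - _) _]opF_neg ?linear0; last by lia.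
  have [?|?] : (r + s < t)%N \/ (t <= r + s)%N by lia.
    by rewrite opF_neg ?scaler0 //; lia.
  by rewrite qbin_at_small ?scale0r //; lia.
have le_trs : (t <= r + s)%N by lia.
have := IH a k t (r + s - t)%N k0 le_tk.
rewrite subnK // En => /(_ erefl (r - i)%N (s - (t - i))%N).
have -> : (r - i + (s - (t - i)) = r + s - t)%N by lia.
have [-> -> ->] : [/\ (r - i)%N = r%:Z - i%:Z :> int,
   (s - (t - i))%N = s%:Z - (t%:Z - i%:Z) :> int &
   r%:Z - i%:Z + (s%:Z - (t%:Z - i%:Z)) = r%:Z + s%:Z - t%:Z].
  by split; lia.
by apply; rewrite En.
Qed.

(** Since b is orthogonal to a, moving E_a past F_a meets the same coefficients
    before and after F_b has been applied. *)
Lemma F_commE nu a b (k x y : nat) v : a != b -> pairing (sroot b) a = 0 ->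
  v \in nu.-space ->
  (forall i : nat, (i <= x)%N -> (i <= k)%N ->
    F_ a (x%:Z - i%:Z) (F_ b y (E a (k%:Z - i%:Z) v)) =
    F_ b y (F_ a (x%:Z - i%:Z) (E a (k%:Z - i%:Z) v))) ->
  E a k (F_ a x (F_ b y v)) = E a k (F_ b y (F_ a x v)).
Proof.
move=> ab ba hv IH.
rewrite (EF_diff a b) // (EF_same _ _ _ _ k.+1 _ hv); last by left; lia.
rewrite (EF_same _ _ _ _ k.+1 _ (F_wspace _ b y v hv)); last by left; lia.
rewrite -mulrNz pairing_shift ba mul0r addr0 linear_sum; apply: eq_bigr => i _.
rewrite linearZ; congr (_ *: _); rewrite (EF_diff a b) //.
have [lt_xi|le_ix] := ltnP x i; last exact: IH (leq_ord i).
rewrite (@opF_neg _ _ _ _ _ _ a) ?(@opF_neg _ _ _ _ _ _ a) ?linear0 //; lia.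
Qed.

Lemma F_comm nu a b v : a != b -> pairing (sroot a) b = 0 -> pairing (sroot b) a = 0 ->
  v \in nu.-space -> forall x y : nat, F_ a x (F_ b y v) = F_ b y (F_ a x v).
Proof.
move=> ab Eab Eba hv x y.
pose P (n : nat) (v : M) := forall x y : nat, (x + y)%N = n ->
  F_ a x (F_ b y v) = F_ b y (F_ a x v).
suff : P (x + y)%N v by apply.
move: nu v hv (x + y)%N; apply: F_ind => {x y} [n x y _|nu v n hv IH x y En].
  by rewrite !linear0.
have [Ex|x0] : x = 0%N \/ (0 < x)%N by lia.
  by rewrite Ex !opF0.
have [Ey|y0] : y = 0%N \/ (0 < y)%N by lia.
  by rewrite Ey !opF0.
have wE : nu - sroot a *~ x - sroot b *~ y = nu - sroot b *~ y - sroot a *~ x.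
  by rewrite addrAC.
have hbx := F_wspace _ b y _ hv; have hax := F_wspace _ a x _ hv.
apply/eqP; rewrite -subr_eq0; apply/eqP.
apply: (ker_im (nu - sroot b *~ y - sroot a *~ x)).
- rewrite -scaleN1r; apply: wspaceD; first exact: F_wspace.
  by apply: wspaceZ; rewrite -wE; exact: F_wspace.
- rewrite -scaleN1r; apply: imF_add; first exact: F_imF.
  by apply: imF_scale; rewrite -wE; exact: F_imF.
move=> c k k0; rewrite linearB /=; apply/eqP; rewrite subr_eq0; apply/eqP.
have IH' (i x' y' : nat) : (i <= k)%N -> (x' + y' + i = n)%N ->
    F_ a x' (F_ b y' (E c (k%:Z - i%:Z) v)) = F_ b y' (F_ a x' (E c (k%:Z - i%:Z) v)).
  by move=> le_ik E'; apply: (IH c k i (x' + y')%N).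
have [Eca|nca] := eqVneq c a.
  subst c; apply: (F_commE _ _ _ _ _ _ _ _ _ hv) => // i le_ix le_ik.
  by rewrite subzn // IH' //; lia.
have [Ecb|ncb] := eqVneq c b.
  subst c; apply/esym; apply: (F_commE _ _ _ _ _ _ _ _ _ hv) => // i le_ix le_ik.
  by rewrite subzn // IH' //; lia.
rewrite !(EF_diff c a) // !(EF_diff c b) // !(EF_diff c a) //.
by have := IH' 0%N x y isT; rewrite subr0 => -> //; lia.
Qed.

Lemma serre_comb_eq (m : nat) (T1 T2 : int -> int -> M) :
  (forall p : nat, (p <= m)%N -> T1 p (m%:Z - p%:Z) = T2 p (m%:Z - p%:Z)) ->
  serre_comb q m T1 = serre_comb q m T2.
Proof.
move=> eqT; apply: eq_bigr => p _; have le_pm := leq_ord p.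
by rewrite eqT.
Qed.

Lemma serre_combD (m : nat) (T1 T2 : int -> int -> M) :
  serre_comb q m (fun x y => T1 x y + T2 x y) = serre_comb q m T1 + serre_comb q m T2.
Proof. by rewrite /serre_comb -big_split; apply: eq_bigr => p _; rewrite scalerDr. Qed.

Lemma serre_combN (m : nat) (T : int -> int -> M) :
  serre_comb q m (fun x y => - T x y) = - serre_comb q m T.
Proof. by rewrite /serre_comb -sumrN; apply: eq_bigr => p _; rewrite scalerN. Qed.

Lemma serre_comb_linear (m : nat) (T : int -> int -> M) (f : {linear M -> M}) :
  f (serre_comb q m T) = serre_comb q m (fun x y => f (T x y)).
Proof. by rewrite linear_sum; apply: eq_bigr => p _; rewrite linearZ. Qed.

Lemma serre_comb_scale (m : nat) (x : int) (w : M) : (1 < m)%N ->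
  serre_comb q m (fun r s => qbin_at (x + s) 1 *: (qbin_at m r *: w)) = 0.
Proof.
move=> m1; rewrite -(scale0r w) -(qbin_at_serre_sum _ _ q_neq0 m x m1) scaler_suml.
by apply: eq_bigr => p _; rewrite !scalerA !mulrA addrA.
Qed.

Lemma pairing_shiftN nu a (n : int) b :
  pairing (nu - sroot a *~ n) b = pairing nu b - pairing (sroot a) b * n.
Proof. by rewrite -mulrNz pairing_shift mulrN. Qed.

Lemma EF_one_right nu a (k : int) v : v \in nu.-space ->
  E a k (F_ a 1 v) = F_ a 1 (E a k v) + qbin_at (pairing nu a - 1 + k) 1 *: E a (k - 1) v.
Proof.
move=> hv; rewrite (EF_same _ _ _ _ 2 _ hv); last by right.
by rewrite big_ord_recl big_ord1 /= !subr0 qbin_at0 // scale1r subrr opF0.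
Qed.

Lemma EF_one_left nu a (k : int) v : v \in nu.-space ->
  E a 1 (F_ a k v) = F_ a k (E a 1 v) + qbin_at (pairing nu a - k + 1) 1 *: F_ a (k - 1) v.
Proof.
move=> hv; rewrite (EF_same _ _ _ _ 2 _ hv); last by left.
by rewrite big_ord_recl big_ord1 /= !subr0 qbin_at0 // scale1r subrr opE0.
Qed.

Lemma F_divpow_sub nu a v (m r : nat) : v \in nu.-space -> (r <= m)%N ->
  F_ a r (F_ a (m%:Z - r%:Z) v) = qbin_at m r *: F_ a m v.
Proof.
move=> hv le_rm; rewrite subzn // (F_divpow _ _ _ hv) -subzn //.
by rewrite addrC subrK.
Qed.

(** E-operators of b leave an alternating sum times F_a^(m), killed by
    serre_comb_scale; E-operators of a leave shorter Serre combinations on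
    higher weights, by serre_vanish. *)
Lemma F_serre nu a b v : a != b ->
  pairing (sroot a) b = -1 -> pairing (sroot b) a = -1 -> v \in nu.-space ->
  forall m : nat, (1 < m)%N ->
  serre_comb q m (fun x y => F_ a x (F_ b 1 (F_ a y v))) = 0.
Proof.
move=> ab Eab Eba hv m; move: nu v hv m.
apply: F_ind => [m _|nu v m hv IH m1].
  by rewrite /serre_comb big1 // => p _; rewrite !linear0.
have wE (p : nat) : (p <= m)%N -> nu - sroot a *~ (m%:Z - p%:Z) - sroot b - sroot a *~ p
   = nu - sroot a *~ m - sroot b.
  by move=> _; rewrite mulrzBr opprB addrAC; congr (_ - _); rewrite addrA addrAC addrK.
apply: (ker_im (nu - sroot a *~ m - sroot b)).
- apply: wspace_sum => p; apply: wspaceZ; rewrite -(wE p) ?leq_ord //.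
  by apply/F_wspace/(F_wspace _ b 1)/F_wspace.
- apply: imF_sum => p; apply: imF_scale; rewrite -(wE p) ?leq_ord //.
  have [Ep|p0] := posnP p.
    rewrite Ep opF0 subr0 subr0; apply: (F_imF _ b 1) => //; exact: F_wspace.
  by apply: F_imF => //; apply/(F_wspace _ b 1)/F_wspace.
move=> c k k0; rewrite serre_comb_linear.
have IH0 : serre_comb q m (fun x y => F_ a x (F_ b 1 (F_ a y (E c k v)))) = 0.
  by have := IH c k 0%N m k0 isT (addn0 m) m1; rewrite subr0.
have [Eca|nca] := eqVneq c a; last first.
  have [Ecb|ncb] := eqVneq c b; last first.
    rewrite -[RHS]IH0; apply: serre_comb_eq => p _.
    by rewrite /= (EF_diff c a) // (EF_diff c b) // (EF_diff c a).
  subst c.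
  transitivity (serre_comb q m (fun x y => F_ a x (F_ b 1 (F_ a y (E b k v)))) +
    serre_comb q m (fun x y => qbin_at (pairing nu b - 1 + k%:Z + y) 1 *:
      (qbin_at m x *: F_ a m (E b (k%:Z - 1) v)))).
    rewrite -serre_combD; apply: serre_comb_eq => p le_pm.
    rewrite /= (EF_diff b a) // (EF_one_right _ _ _ _ (F_wspace _ a _ _ hv)).
    rewrite pairing_shiftN Eab mulN1r opprK linearD linearZ /= !(EF_diff b a) //.
    congr (_ + _).
    rewrite (F_divpow_sub _ _ _ _ _ (E_wspace _ b (k%:Z - 1) _ hv)) //.
    by congr (qbin_at _ _ *: _); ring.
  by rewrite IH0 add0r serre_comb_scale.
(* B is what the upper indices of all the binomials have in common. *)
subst c; pose B := pairing nu a - m%:Z - m%:Z + k%:Z.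
transitivity (serre_comb q m (fun x y => \sum_(i < k.+1) \sum_(j < k.+1)
   (qbin_at (B + 1 + `|x|%N%:Z) i * qbin_at (B + m%:Z + `|x|%N%:Z - i%:Z) j) *:
   F_ a (x - i%:Z) (F_ b 1 (F_ a (y - j%:Z) (E a (k%:Z - (i + j)%N%:Z) v))))).
  apply: serre_comb_eq => p le_pm.
  rewrite (EF_same _ _ _ _ k.+1 _ (F_wspace _ b 1 _ (F_wspace _ a _ _ hv)));
    last by left; lia.
  apply: eq_bigr => i _; rewrite (EF_diff a b) //.
  rewrite (EF_same _ _ _ _ k.+1 _ hv); last by left; lia.
  rewrite [F_ b 1 _]linear_sum [F_ a _ (\sum_(_ < _) _)]linear_sum scaler_sumr.
  apply: eq_bigr => j _.
  rewrite [F_ b 1 _]linearZ [F_ a _ (_ *: _)]linearZ scalerA /=.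
  rewrite (_ : k%:Z - (i + j)%N%:Z = k%:Z - i%:Z - j%:Z);
    last by rewrite PoszD; ring.
  rewrite !pairing_shiftN pairing_self Eba /B.
  by congr (qbin_at _ _ * qbin_at _ _ *: _); ring.
apply: (serre_vanish _ _ _ m k
  (fun r i j => qbin_at (B + 1 + r%:Z) i * qbin_at (B + m%:Z + r%:Z - i%:Z) j)
  (fun t => q ^ ((B + 2) * t%:Z))
  (fun x y t => F_ a x (F_ b 1 (F_ a y (E a (k%:Z - t%:Z) v)))) q_neq0 m1).
- by move=> x y t x0; rewrite opF_neg.
- by move=> x y t y0; rewrite [F_ a y _]opF_neg // !linear0.
- by move=> x y t lt_kt; rewrite opE_neg ?linear0 //; lia.
- move=> p t.
  rewrite -expfzDr // (_ : (B + 2) * t%:Z + p%:Z * t%:Z = (B + p%:Z + 2) * t%:Z); last by ring.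
  rewrite -qbin_at_serreF //; apply: eq_bigr => i _.
  rewrite -subzn ?leq_ord // PoszD.
  by congr (_ * (qbin_at _ _ * qbin_at _ _)); ring.
- by move=> n t le_tk En n1; exact: IH a k t n k0 le_tk En n1.
Qed.

(** * Relations between the E-operators *)

Lemma kerE_E mu a (n : nat) v : (0 < n)%N -> kerE M mu v -> E a n v = 0.
Proof. by move=> n0 [_]; apply. Qed.

(** Written with [r+s choose s], the form in which qbinom_saalschutz applies
    with the roles of r and s exchanged. *)
Lemma E_divpow nu a v : v \in nu.-space -> forall r s : nat,
  E a r (E a s v) = qbin_at (r%:Z + s%:Z) s *: E a (r%:Z + s%:Z) v.
Proof.
move: nu v; apply: E_ind => [u v hu hv r s|mu v hv r s|nu c k v k0 hv IH r s].
- by rewrite !linearD hu hv.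
- have [Es|s0] := posnP s.
    by rewrite Es addr0 opE0 qbin_at0 // scale1r.
  rewrite [E a s v](kerE_E _ _ _ _ s0 hv) linear0 -PoszD.
  by rewrite (kerE_E _ _ _ _ _ hv) ?scaler0 // addn_gt0 s0 orbT.
have [Eca|nca] := eqVneq a c; last by rewrite !(EF_diff a c) // IH linearZ.
subst c.
rewrite (EF_same _ _ _ _ k.+1 _ hv); last by right; lia.
rewrite (EF_same _ _ _ _ k.+1 _ hv); last by right; lia.
pose g (j i : nat) := (qbin_at (pairing nu a - k%:Z + s%:Z) j *
   qbin_at (pairing nu a + 2 * (s%:Z - j%:Z) - (k%:Z - j%:Z) + r%:Z) i) *:
   F_ a (k%:Z - (j + i)%N%:Z) (E a (r%:Z - i%:Z) (E a (s%:Z - j%:Z) v)).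
transitivity (\sum_(j < k.+1) \sum_(i < k.+1) g j i).
  rewrite linear_sum; apply: eq_bigr => j _; rewrite linearZ /=.
  rewrite (EF_same _ _ _ _ k.+1 _ (E_wspace _ a _ _ hv)); last by right; lia.
  rewrite pairing_shift pairing_self scaler_sumr; apply: eq_bigr => i _.
  by rewrite scalerA /g (_ : k%:Z - (j + i)%N%:Z = k%:Z - j%:Z - i%:Z) // PoszD; ring.
rewrite (sum_triangle _ _ g); last first.
  by move=> i j lt_k; rewrite /g opF_neg ?scaler0 //; lia.
rewrite scaler_sumr; apply: eq_bigr => t _; have le_tk := leq_ord t.
rewrite scalerA [r%:Z + s%:Z]addrC -qbin_at_saalschutz // scaler_suml.
apply: eq_bigr => j _; have le_jt := leq_ord j.
rewrite /g subnKC // -[in RHS]scalerA -(subzn le_jt).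
rewrite (_ : pairing nu a + 2 * (s%:Z - j%:Z) - (k%:Z - j%:Z) + r%:Z =
  pairing nu a - k%:Z + (s%:Z + r%:Z) + s%:Z - j%:Z); last by ring.
rewrite (_ : pairing nu a - k%:Z + s%:Z =
  pairing nu a - k%:Z + (s%:Z + r%:Z) - r%:Z); last by ring.
congr (_ *: _).
have [lt_sj|le_js] := ltnP s j.
  by rewrite [E a (s%:Z - _) _]opE_neg ?qbin_at_lt0 ?scale0r ?linear0 //; lia.
have [lt_r|le_r] : (r < t - j)%N \/ (t - j <= r)%N by lia.
  rewrite opE_neg ?linear0; last by lia.
  have [?|?] : (r + s < t)%N \/ (t <= r + s)%N by lia.
    by rewrite [E a (_ - t%:Z) _]opE_neg ?linear0 ?scaler0 //; lia.
  by rewrite qbin_at_small ?scale0r //; lia.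
have le_trs : (t <= r + s)%N by lia.
have := IH (r - (t - j))%N (s - j)%N.
have [-> -> ->] : [/\ (r - (t - j))%N = r%:Z - (t%:Z - j%:Z) :> int,
   (s - j)%N = s%:Z - j%:Z :> int &
   r%:Z - (t%:Z - j%:Z) + (s%:Z - j%:Z) = s%:Z + r%:Z - t%:Z].
  by split; lia.
by move=> ->; rewrite linearZ.
Qed.

Lemma E_divpow_sub nu a v (m r : nat) : v \in nu.-space -> (r <= m)%N ->
  E a r (E a (m%:Z - r%:Z) v) = qbin_at m r *: E a m v.
Proof.
move=> hv le_rm; rewrite subzn // (E_divpow _ _ _ hv) -subzn //.
by rewrite addrC subrK -qbin_at_sym.
Qed.

Lemma E_commF nu a b (x y k : nat) v : a != b -> pairing (sroot b) a = 0 ->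
  v \in nu.-space ->
  (forall x' : nat, E a x' (E b y v) = E b y (E a x' v)) ->
  E a x (E b y (F_ a k v)) = E b y (E a x (F_ a k v)).
Proof.
move=> ab ba hv IH; have nba : b != a by rewrite eq_sym.
rewrite (EF_diff b a) // (EF_same _ _ _ _ k.+1 _ hv); last by right; lia.
rewrite (EF_same _ _ _ _ k.+1 _ (E_wspace _ b y v hv)); last by right; lia.
rewrite pairing_shift ba mul0r addr0 linear_sum; apply: eq_bigr => i _.
rewrite linearZ; congr (_ *: _); rewrite /= (EF_diff b a) //.
have [lt_xi|le_ix] := ltnP x i; last by rewrite (subzn le_ix) IH.
by rewrite (@opE_neg _ _ _ _ _ _ a) ?(@opE_neg _ _ _ _ _ _ a) ?linear0 //; lia.
Qed.

Lemma E_comm nu a b v : a != b -> pairing (sroot a) b = 0 -> pairing (sroot b) a = 0 ->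
  v \in nu.-space -> forall x y : nat, E a x (E b y v) = E b y (E a x v).
Proof.
move=> ab Eab Eba; move: nu v.
apply: E_ind => [u v hu hv x y|mu v hv x y|nu c k v k0 hv IH x y].
- by rewrite !linearD hu hv.
- have [Ex|x0] := posnP x; first by rewrite Ex !opE0.
  have [Ey|y0] := posnP y; first by rewrite Ey !opE0.
  by rewrite [E b y v](kerE_E _ _ _ _ y0 hv) [E a x v](kerE_E _ _ _ _ x0 hv) !linear0.
have [Eca|nca] := eqVneq a c.
  by subst c; apply: (E_commF _ _ _ _ _ _ _ _ _ hv).
have [Ecb|ncb] := eqVneq b c.
  by subst c; apply/esym/(E_commF _ _ _ _ _ _ _ _ _ hv) => //; rewrite eq_sym.
by rewrite !(EF_diff b c) // !(EF_diff a c) // !(EF_diff b c) // IH.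
Qed.

(** On ker E each term vanishes: its first operator to act has positive degree,
    except when that degree is 0, and then it is E_b.  On im F the argument is
    that of F_serre with the operators moved in the opposite direction. *)
Lemma E_serre nu a b v : a != b ->
  pairing (sroot a) b = -1 -> pairing (sroot b) a = -1 -> v \in nu.-space ->
  forall m : nat, (1 < m)%N ->
  serre_comb q m (fun x y => E a x (E b 1 (E a y v))) = 0.
Proof.
move=> ab Eab Eba; move: nu v; have nba : b != a by rewrite eq_sym.
apply: E_ind => [u v hu hv m m1|mu v hv m m1|nu c k v k0 hv IH m m1].
- rewrite -[RHS]addr0 -{1}(hu m m1) -(hv m m1) -serre_combD.
  by apply: serre_comb_eq => p _; rewrite !linearD.
- rewrite /serre_comb big1 // => p _; have := leq_ord p.
  rewrite leq_eqVlt => /orP[/eqP->|lt_pm].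
    by rewrite subrr opE0 (kerE_E _ _ 1 _ _ hv) // linear0 scaler0.
  rewrite subzn ?leq_ord // [E a (m - p)%N v](kerE_E _ _ _ _ _ hv) ?subn_gt0 //.
  by rewrite !linear0.
have IHF c' (n : int) : serre_comb q m (fun x y => F_ c' n (E a x (E b 1 (E a y v)))) = 0.
  by rewrite -serre_comb_linear IH // linear0.
have [Eca|nca] := eqVneq a c; last first.
  have [Ecb|ncb] := eqVneq b c; last first.
    rewrite -[RHS](IHF c k); apply: serre_comb_eq => p _.
    by rewrite (EF_diff a c) // (EF_diff b c) // (EF_diff a c).
  subst c.
  transitivity (serre_comb q m (fun x y => F_ b k (E a x (E b 1 (E a y v)))) +
    - serre_comb q m (fun x y => qbin_at (k%:Z - 1 - pairing nu b + y) 1 *: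
      (qbin_at m x *: F_ b (k%:Z - 1) (E a m v)))); last first.
    by rewrite IHF serre_comb_scale // subr0.
  rewrite -serre_combN.
  rewrite -serre_combD; apply: serre_comb_eq => p le_pm.
  rewrite (EF_diff a b) // (EF_one_left _ _ _ _ (E_wspace _ a _ _ hv)).
  rewrite pairing_shift Eab linearD linearZ /= !(EF_diff a b) //.
  congr (_ + _); rewrite (E_divpow_sub _ _ _ _ _ hv) // linearZ /= -scaleNr -qbin_atN_1 //.
  by congr (qbin_at _ _ *: _); ring.
(* B is what the upper indices of all the binomials have in common. *)
subst c; pose B := pairing nu a - k%:Z + m%:Z.
transitivity (serre_comb q m (fun x y => \sum_(i < k.+1) \sum_(j < k.+1)
   (qbin_at (B + m%:Z - 1 - `|x|%N%:Z - j%:Z) i * qbin_at (B - `|x|%N%:Z) j) *: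
   F_ a (k%:Z - (i + j)%N%:Z) (E a (x - i%:Z) (E b 1 (E a (y - j%:Z) v))))).
  apply: serre_comb_eq => p le_pm; rewrite exchange_big /=.
  rewrite (EF_same _ _ _ _ k.+1 _ hv); last by right; lia.
  rewrite [E b 1 _]linear_sum [E a _ (\sum_(_ < _) _)]linear_sum; apply: eq_bigr => j _.
  rewrite [E b 1 _]linearZ [E a _ (_ *: _)]linearZ /= (EF_diff b a) //.
  rewrite (EF_same _ _ _ _ k.+1 _ (E_wspace _ b 1 _ (E_wspace _ a _ _ hv)));
    last by right; lia.
  rewrite scaler_sumr; apply: eq_bigr => i _.
  rewrite scalerA mulrC (_ : k%:Z - (i + j)%N%:Z = k%:Z - j%:Z - i%:Z);
    last by rewrite PoszD; ring.
  rewrite !pairing_shift pairing_self Eba /B.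
  by congr (qbin_at _ _ * qbin_at _ _ *: _); ring.
apply: (serre_vanish _ _ _ m k
  (fun r i j => qbin_at (B + m%:Z - 1 - r%:Z - j%:Z) i * qbin_at (B - r%:Z) j)
  (fun t => (-1) ^+ t * q ^ ((t%:Z + 1 - B - m%:Z) * t%:Z))
  (fun x y t => F_ a (k%:Z - t%:Z) (E a x (E b 1 (E a y v)))) q_neq0 m1).
- by move=> x y t x0; rewrite opE_neg // linear0.
- by move=> x y t y0; rewrite [E a y _]opE_neg // !linear0.
- by move=> x y t lt_kt; rewrite opF_neg //; lia.
- move=> p t.
  rewrite -[_ * _ * q ^ _]mulrA -expfzDr //.
  rewrite (_ : _ + p%:Z * t%:Z = (t%:Z + 1 - (B - p%:Z) - m%:Z) * t%:Z); last by ring.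
  rewrite -qbin_at_serreE //; apply: eq_bigr => i _.
  rewrite -subzn ?leq_ord // PoszD.
  by congr (_ * (qbin_at _ _ * qbin_at _ _)); ring.
- by move=> n t le_tk En n1; rewrite -serre_comb_linear IH // linear0.
Qed.

Lemma fsbig_serre (m : nat) (T : int -> int -> M) :
  (forall x y, x < 0 -> T x y = 0) -> (forall x y, y < 0 -> T x y = 0) ->
  \sum_(r \in [set: int]%classic) ((-1) ^ r * q ^ (r * (2 - m%:Z))) *: T r (m%:Z - r)
    = serre_comb q m T.
Proof.
move=> Tx Ty; rewrite (fsbig_int_nat _ m.+1) => [|r r0|r le_mr] //.
  by rewrite Tx ?scaler0.
by rewrite Ty ?scaler0 //; lia.
Qed.

End Relations.

(** * The commutation and Serre relations *)

Local Open Scope classical_set_scope.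

Theorem proposition5p3 (F : archiRealFieldType) (V : vectType F)
  (R : root_system V) (Pi : root_base R) (Pi_sl : simply_laced Pi)
  (K : fieldType) (q : K) (q_neq0 : q != 0)
  (a b : simple_root Pi) (neq_ab : a != b)
  (m n : int) (m_ge0 : 0 <= m) (n_ge0 : 0 <= n)
  (M : objX Pi q) (v : M) :
  (pairing (sroot a) b = 0 ->
     opF a m (opF b n v) = opF b n (opF a m v) /\
     opE a m (opE b n v) = opE b n (opE a m v)) /\
  (pairing (sroot a) b = -1 -> 2 <= m ->
     \sum_(r \in [set: int])
        ((-1) ^ r * q ^ (r * (2 - m))) *: opF a r (opF b 1 (opF a (m - r) v)) = 0 /\
     \sum_(r \in [set: int])
        ((-1) ^ r * q ^ (r * (2 - m))) *: opE a r (opE b 1 (opE a (m - r) v)) = 0).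
Proof.
case: m m_ge0 => // m _; case: n n_ge0 => // n _.
have sym := pairing_sym _ _ _ _ Pi_sl _ _ neq_ab.
split=> [ab0|abN1 m_ge2].
  have ba0 : pairing (sroot b) a = 0 by rewrite -sym.
  split; move: v; apply: wspace_ext => [|u v hu hv|mu v hv]; rewrite ?linear0 //.
  - by rewrite !linearD hu hv.
  - exact: (F_comm _ _ _ _ _ _ q_neq0 _ _ _ _ _ neq_ab ab0 ba0 hv).
  - by rewrite !linearD hu hv.
  - exact: (E_comm _ _ _ _ _ _ q_neq0 _ _ _ _ _ neq_ab ab0 ba0 hv).
have baN1 : pairing (sroot b) a = -1 by rewrite -sym.
have m1 : (1 < m)%N by rewrite -ltz_nat; lia.
split.
- rewrite (fsbig_serre _ _ _ _ _ _ q_neq0 M m (fun x y => opF a x (opF b 1 (opF a y v)))).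
  + move: v; apply: wspace_ext => [|u v hu hv|mu v hv].
    * by rewrite /serre_comb big1 // => p _; rewrite !linear0.
    * rewrite -[RHS]addr0 -{1}hu -hv -serre_combD.
      by apply: serre_comb_eq => p _; rewrite !linearD.
    * exact: (F_serre _ _ _ _ _ _ q_neq0 _ _ _ _ _ neq_ab abN1 baN1 hv).
  + by move=> x y x0; rewrite opF_neg.
  + by move=> x y y0; rewrite [opF a y v]opF_neg // !linear0.
- rewrite (fsbig_serre _ _ _ _ _ _ q_neq0 M m (fun x y => opE a x (opE b 1 (opE a y v)))).
  + move: v; apply: wspace_ext => [|u v hu hv|mu v hv].
    * by rewrite /serre_comb big1 // => p _; rewrite !linear0.
    * rewrite -[RHS]addr0 -{1}hu -hv -serre_combD.
      by apply: serre_comb_eq => p _; rewrite !linearD.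
    * exact: (E_serre _ _ _ _ _ _ q_neq0 _ _ _ _ _ neq_ab abN1 baN1 hv).
  + by move=> x y x0; rewrite opE_neg.
  + by move=> x y y0; rewrite [opE a y v]opE_neg // !linear0.
Qed.
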